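(* Let $c$ be a real number with $-\pi/3<c<\pi/3$, and for $s\in\mathbb{C}$ define $$D^*(s)=\frac{1}{2\pi i}\int_{c-i\infty}^{c+i\infty}F(z)\,u(z)^{-s}\,\mathrm{d}z ,$$ where $F(z)=-\dfrac{4\sqrt3\cos z}{1+2\cos(2z)}$ and $u(z)=\dfrac{(\pi-3z)(2\pi-3z)}{6\pi^2}$. Then $D^*$ is the analytic continuation to all $s\in\mathbb{C}$ of the Dirichlet generating function $D(s)=\sum_{n=1}^\infty a_n n^{-s}$, $\operatorname{Re}(s)>0$, where $(a_n)$ are the coefficients in $\prod_{n\ge1}(1-q^n)=\sum_{n\ge0}a_nq^n$.
   Context: The coefficients $a_n$ of Euler's pentagonal number theorem are: $a_0=1$; $a_n=(-1)^m$ if $n=(3m^2+m)/2$ or $n=(3m^2-m)/2$ for some positive integer $m$; and $a_n=0$ otherwise. The series $D(s)=\sum_{n\ge1}a_nn^{-s}$ is taken in order of increasing $n$ and converges for $\operatorname{Re}(s)>0$. The integral is along the vertical line $\operatorname{Re}(z)=c$, oriented upward. The power $u(z)^{-s}=\exp(-s\log u(z))$ is taken with the principal branch of the logarithm; its branch cuts in $z$ are the segment $[\pi/3,2\pi/3]$ and the vertical line $\operatorname{Re}(z)=\pi/2$, so $u(z)^{-s}$ is holomorphic for $\operatorname{Re}(z)<\pi/3$. The poles of $F$ are exactly the points $k\pi/3$ with $k\in\mathbb{Z}$, $3\nmid k$. *)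

(* Defs.v *)
From Stdlib Require Import Reals ZArith Lia.
From Coquelicot Require Import Coquelicot.

Definition Cexp (z : C) : C :=
  (exp (Re z) * cos (Im z), exp (Re z) * sin (Im z))%R.

Definition Ccos (z : C) : C :=
  ((Cexp (Ci * z) + Cexp (- (Ci * z))) / 2)%C.

(** Principal argument, with values in (-PI, PI]; the value at 0 is junk. *)
Definition Carg (z : C) : R :=
  if Rle_dec 0 (Im z) then acos (Re z / Cmod z) else (- acos (Re z / Cmod z))%R.

Definition Clog (z : C) : C := (ln (Cmod z), Carg z).

Definition Ccpow (w s : C) : C := Cexp (s * Clog w)%C.

(** [euler_partial N n] is the coefficient of [q^n] in the polynomial
    [(1 - q) (1 - q^2) ... (1 - q^N)]. *)
Fixpoint euler_partial (N n : nat) : Z :=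
  match N with
  | O => if Nat.eqb n 0 then 1%Z else 0%Z
  | S N' =>
      (euler_partial N' n -
       (if Nat.leb N n then euler_partial N' (n - N) else 0))%Z
  end.

(** The factors [1 - q^k] with [k > n] do not affect the coefficient of [q^n]
    (see [euler_partial_stable]), so the infinite product may be truncated
    at [N = n]. *)
Definition euler_coeff (n : nat) : Z := euler_partial n n.

Lemma euler_partial_stable (N n : nat) :
  (n <= N)%nat -> euler_partial N n = euler_coeff n.
Proof.
  induction 1 as [|N HN IH]; [reflexivity|].
  cbn [euler_partial]; rewrite IH.
  destruct (Nat.leb_spec (S N) n); lia.
Qed.

(** Parametrization [z = c + i y], [dz = i dy]; the two ends of the line go to
    infinity independently. *)
Definition vline_integrand (f : C -> C) (c : R) (y : R) : C :=
  (f (c, y) * Ci)%C.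

Definition ex_vline_int (f : C -> C) (c : R) : Prop :=
  ex_RInt_gen (V := C_R_NormedModule) (vline_integrand f c)
    (Rbar_locally m_infty) (Rbar_locally p_infty).

Definition vline_int (f : C -> C) (c : R) : C :=
  RInt_gen (V := C_R_CompleteNormedModule) (vline_integrand f c)
    (Rbar_locally m_infty) (Rbar_locally p_infty).

Definition F (z : C) : C :=
  (- (4 * sqrt 3 * Ccos z / (1 + 2 * Ccos (2 * z))))%C.

Definition u (z : C) : C :=
  ((PI - 3 * z) * (2 * PI - 3 * z) / (6 * PI ^ 2))%C.

Definition Dstar_integrand (s z : C) : C := (F z * Ccpow (u z) (- s))%C.

Definition Dstar (c : R) (s : C) : C :=
  (/ (2 * PI * Ci) * vline_int (Dstar_integrand s) c)%C.

(** [Coquelicot] series start at index 0, whence the shift. *)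
Definition is_dirichlet_series (a : nat -> Z) (s l : C) : Prop :=
  is_series (K := C_AbsRing) (V := C_NormedModule)
    (fun k : nat => (IZR (a (S k)) * Ccpow (INR (S k)) (- s))%C) l.

Definition entire (f : C -> C) : Prop :=
  forall s : C, ex_derive (K := C_AbsRing) (V := C_NormedModule) f s.

(* Main.v *)
(** On the lattice [z = n * PI / 3] one has [u z = (n - 1) (n - 2) / 6], so the
    poles of [F] to the left of the line of integration are exactly the points
    where [u] takes generalized pentagonal values, and [F (z - PI) = - F z].
    Moving the line from [Re z = 0] to [Re z = - PI] therefore picks up one pair
    of pentagonal terms and leaves, up to sign, the same integral for the
    translated function [u (z - PI) ^ (- s)]; after [m] steps the remaining
    integral is [O (m ^ (- 2 Re s))].

    No residue theorem is needed: at a pole [p] one moves the line for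
    [F z (h z - h p)], which stays bounded near [p], and the integrals of [F]
    itself over [Re z = 0], [- PI / 2], [- PI] are elementary.  That the
    coefficients are supported on pentagonal numbers follows from Shanks' finite
    form of Euler's identity, and holomorphy in [s] from a quadratic Taylor
    bound under the integral sign. *)

Require Import Defs.
From Stdlib Require Import Reals ZArith Lra Lia Psatz.
From Coquelicot Require Import Coquelicot.

Local Open Scope R_scope.

(** Everything takes place in [Re z < PI / 3], where both linear factors of [u] have positive real
    part: the principal logarithm of [u] is then the sum of their two logarithms minus a constant,
    and no branch cut is met. On a vertical line this logarithm grows only logarithmically with the
    height, so for every [s] the power is at most [K * exp (|y| / 2)], while [F] decays like
    [exp (- |y|)]. The remaining half of the decay gives convergence for all [s], makes the
    horizontal sides vanish, and absorbs the factors [ell] created by differentiating in [s]. The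
    stop at [Re z = - PI / 2] separates the poles [- PI / 3] and [- 2 PI / 3], so that each crossing
    meets a single pole. The integrals of [F] over the three lines are [- 2 PI], [0] and [2 PI], and
    their differences stand in for the residues. Cauchy's theorem is replaced by differentiating a
    vertical integral with respect to its abscissa. *)

(** * The pentagonal number theorem *)

(** [qprod s d k] is the coefficient of [q^k] in
    [(1 - q^(s+1)) ... (1 - q^(s+d))]; letting [k] range over [Z] makes the
    multiplication by a power of [q] a plain translation. *)
Fixpoint qprod (s d : nat) (k : Z) : Z :=
  match d with
  | O => if Z.eqb k 0 then 1%Z else 0%Z
  | S d' => (qprod s d' k - qprod s d' (k - (Z.of_nat s + Z.of_nat d' + 1)))%Z
  end.

Fixpoint triangular (n : nat) : nat :=
  match n with
  | O => O
  | S n' => (triangular n' + S n')%nat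
  end.

(** With [M = m + 1], [pent_lo m] is [(3 M^2 - M) / 2] and [pent_hi m] is [(3 M^2 + M) / 2], written
    like the exponents in Shanks' sum so that no division occurs. *)
Definition pent_lo (m : nat) : nat := (S m * S m + triangular m)%nat.
Definition pent_hi (m : nat) : nat := (S m * S m + triangular (S m))%nat.

Definition Zsign (m : nat) : Z := if Nat.even m then 1%Z else (-1)%Z.

Lemma Zsign_S (m : nat) : Zsign (S m) = (- Zsign m)%Z.
Proof.
unfold Zsign. rewrite Nat.even_succ, <- Nat.negb_even. now destruct Nat.even.
Qed.

Lemma qprod_neg (s d : nat) (k : Z) : (k < 0)%Z -> qprod s d k = 0%Z.
Proof.
revert k; induction d as [|d IH]; intros k Hk; cbn [qprod].
- now destruct (Z.eqb_spec k 0); [lia|].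
- now rewrite !IH by lia.
Qed.

(** The recursion of [qprod] strips the largest factor; Shanks' telescoping has to strip the
    smallest, [1 - q^(s+1)], to pass from [P_n / P_s] to [P_n / P_(s+1)]. *)
Lemma qprod_left (s d : nat) (k : Z) :
  qprod s (S d) k =
  (qprod (S s) d k - qprod (S s) d (k - (Z.of_nat s + 1)))%Z.
Proof.
revert k; induction d as [|d IH]; intros k.
- cbn [qprod]. now replace (k - (Z.of_nat s + Z.of_nat 0 + 1))%Z
    with (k - (Z.of_nat s + 1))%Z by lia.
- change (qprod s (S (S d)) k) with
    (qprod s (S d) k - qprod s (S d) (k - (Z.of_nat s + Z.of_nat (S d) + 1)))%Z.
  rewrite !IH. cbn [qprod].
  replace (k - (Z.of_nat s + Z.of_nat (S d) + 1))%Z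
    with (k - (Z.of_nat (S s) + Z.of_nat d + 1))%Z by lia.
  replace (k - (Z.of_nat s + 1) - (Z.of_nat (S s) + Z.of_nat d + 1))%Z
    with (k - (Z.of_nat (S s) + Z.of_nat d + 1) - (Z.of_nat s + 1))%Z by lia.
  lia.
Qed.

Lemma euler_partial_qprod (N n : nat) : euler_partial N n = qprod 0 N (Z.of_nat n).
Proof.
revert n; induction N as [|N IH]; intros n; cbn [euler_partial qprod].
- destruct n; reflexivity.
- rewrite <- IH. f_equal. destruct (Nat.leb_spec (S N) n).
  + rewrite IH. f_equal. lia.
  + symmetry; apply qprod_neg. lia.
Qed.

(** The coefficient of [q^k] in [(-1)^s (P_n / P_s) q^(s n + s (s + 1) / 2)], where
    [P_n = (1 - q) ... (1 - q^n)]. *)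
Definition shanks_term (n s : nat) (k : Z) : Z :=
  (Zsign s * qprod s (n - s)
    (k - (Z.of_nat s * Z.of_nat n + Z.of_nat (triangular s))))%Z.

Fixpoint shanks_sum (n m : nat) (k : Z) : Z :=
  match m with
  | O => shanks_term n 0 k
  | S m' => (shanks_sum n m' k + shanks_term n m k)%Z
  end.

(* Shanks: the sums for [n + 1] and [n] telescope against each other. *)
Lemma shanks_sum_diff (n m : nat) (k : Z) : (m <= n)%nat ->
  (shanks_sum (S n) m k - shanks_sum n m k)%Z =
  (- Zsign m * qprod m (n - m)
     (k - ((Z.of_nat m + 1) * (Z.of_nat n + 1) + Z.of_nat (triangular m))))%Z.
Proof.
induction m as [|m IH]; intros Hm.
- cbn [shanks_sum]. unfold shanks_term.
  replace (S n - 0)%nat with (S n) by lia. rewrite Nat.sub_0_r.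
  cbn [qprod triangular]. change (Zsign 0) with 1%Z.
  replace (k - (Z.of_nat 0 * Z.of_nat (S n) + Z.of_nat 0))%Z with k by lia.
  replace (k - (Z.of_nat 0 * Z.of_nat n + Z.of_nat 0))%Z with k by lia.
  replace (k - ((Z.of_nat 0 + 1) * (Z.of_nat n + 1) + Z.of_nat 0))%Z
    with (k - (Z.of_nat 0 + Z.of_nat n + 1))%Z by lia.
  lia.
- cbn [shanks_sum]. specialize (IH ltac:(lia)).
  remember (n - S m)%nat as d eqn:Ed.
  (* With its smallest factor split off, the induction hypothesis involves the same product
     [qprod (S m) d] as the two new terms; only a relation between its three values [q1], [q2], [q3]
     remains. *)
  replace (n - m)%nat with (S d) in IH by lia.
  rewrite qprod_left in IH.
  unfold shanks_term. replace (S n - S m)%nat with (S d) by lia. rewrite <- Ed.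
  rewrite Zsign_S. cbn [qprod triangular].
  set (K := (k - ((Z.of_nat m + 1) * (Z.of_nat n + 1) + Z.of_nat (triangular m)))%Z) in *.
  replace (k - (Z.of_nat (S m) * Z.of_nat (S n) + Z.of_nat (triangular m + S m)))%Z
    with (K - (Z.of_nat m + 1))%Z by (unfold K; lia).
  replace (k - (Z.of_nat (S m) * Z.of_nat n + Z.of_nat (triangular m + S m)))%Z
    with K by (unfold K; lia).
  replace (k - ((Z.of_nat (S m) + 1) * (Z.of_nat n + 1) +
    Z.of_nat (triangular m + S m)))%Z
    with (K - (Z.of_nat m + 1) - (Z.of_nat (S m) + Z.of_nat d + 1))%Z
    by (unfold K; lia).
  generalize dependent (qprod (S m) d K).
  generalize (qprod (S m) d (K - (Z.of_nat m + 1))).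
  generalize (qprod (S m) d (K - (Z.of_nat m + 1) - (Z.of_nat (S m) + Z.of_nat d + 1))).
  intros q1 q2 q3 IH. nia.
Qed.

Definition indic (k n : nat) : Z := if Nat.eqb k n then 1%Z else 0%Z.

(** At [m = n] the remainder of [shanks_sum_diff] is a single monomial of exponent [pent_lo n], and
    the extra term [s = n + 1] is a single monomial of exponent [pent_hi n]. *)
Lemma shanks_sum_diag_S (n k : nat) :
  shanks_sum (S n) (S n) (Z.of_nat k) =
  (shanks_sum n n (Z.of_nat k)
   - Zsign n * (indic k (pent_lo n) + indic k (pent_hi n)))%Z.
Proof.
pose proof (shanks_sum_diff n n (Z.of_nat k) (le_n n)) as H.
cbn [shanks_sum]. unfold shanks_term at 1. rewrite Nat.sub_diag in H |- *.
cbn [qprod] in H |- *. rewrite Zsign_S.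
unfold indic, pent_lo, pent_hi.
destruct (Nat.eqb_spec k (S n * S n + triangular n)) as [E|E];
destruct (Z.eqb_spec (Z.of_nat k - ((Z.of_nat n + 1) * (Z.of_nat n + 1) +
  Z.of_nat (triangular n))) 0) as [E'|E']; try lia;
destruct (Nat.eqb_spec k (S n * S n + triangular (S n))) as [G|G];
destruct (Z.eqb_spec (Z.of_nat k - (Z.of_nat (S n) * Z.of_nat (S n) +
  Z.of_nat (triangular (S n)))) 0) as [G'|G']; try lia.
Qed.

(** The terms with [s >= 1] start at exponent [s n + s (s + 1) / 2 > n], so up to [q^n] only the
    term [s = 0], the full product, is visible. *)
Lemma shanks_sum_low (n m k : nat) : (k <= n)%nat ->
  shanks_sum n m (Z.of_nat k) = euler_coeff k.
Proof.
intros Hk. induction m as [|m IH].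
- cbn [shanks_sum]. unfold shanks_term. rewrite Nat.sub_0_r.
  change (Zsign 0) with 1%Z. cbn [triangular].
  replace (Z.of_nat k - (Z.of_nat 0 * Z.of_nat n + Z.of_nat 0))%Z
    with (Z.of_nat k) by lia.
  rewrite <- euler_partial_qprod, euler_partial_stable by exact Hk. lia.
- cbn [shanks_sum]. rewrite IH. unfold shanks_term.
  rewrite qprod_neg; [lia|]. cbn [triangular]. nia.
Qed.

Lemma pent_lo_lt_hi_lt_lo (j : nat) :
  (pent_lo j < pent_hi j < pent_lo (S j))%nat.
Proof. unfold pent_lo, pent_hi; cbn [triangular]; nia. Qed.

Lemma pent_lo_ge (j : nat) : (S j <= pent_lo j)%nat.
Proof. unfold pent_lo; nia. Qed.

Lemma pent_hi_lt_lo (i j : nat) : (i < j)%nat -> (pent_hi i < pent_lo j)%nat.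
Proof.
induction 1 as [|j H IH]; [apply pent_lo_lt_hi_lt_lo|].
pose proof (pent_lo_lt_hi_lt_lo j). lia.
Qed.

Lemma shanks_sum_diag_0 (n k : nat) : (0 < k)%nat ->
  (forall j, (j < n)%nat -> k <> pent_lo j /\ k <> pent_hi j) ->
  shanks_sum n n (Z.of_nat k) = 0%Z.
Proof.
intros Hk. induction n as [|n IH]; intros H.
- cbn. destruct k; [lia|reflexivity].
- rewrite shanks_sum_diag_S, IH by (intros; apply H; lia).
  destruct (H n ltac:(lia)) as [H1 H2]. unfold indic.
  apply Nat.eqb_neq in H1, H2. rewrite H1, H2. lia.
Qed.

Lemma euler_coeff_0 (k : nat) : (0 < k)%nat ->
  (forall j, k <> pent_lo j /\ k <> pent_hi j) -> euler_coeff k = 0%Z.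
Proof.
intros Hk H. rewrite <- (shanks_sum_low k k k (le_n k)).
now apply shanks_sum_diag_0.
Qed.

(** The diagonal step from [j] to [j + 1] creates the value at [k]; all other steps touch only
    pentagonal numbers different from [k]. *)
Lemma shanks_sum_diag_pent (j k n : nat) : k = pent_lo j \/ k = pent_hi j ->
  (j < n)%nat -> shanks_sum n n (Z.of_nat k) = Zsign (S j).
Proof.
intros Hk. induction 1 as [|n Hn IH].
- rewrite shanks_sum_diag_S, shanks_sum_diag_0.
  + pose proof (pent_lo_lt_hi_lt_lo j) as T. rewrite Zsign_S. unfold indic.
    destruct Hk as [-> | ->]; rewrite Nat.eqb_refl;
    match goal with |- context [Nat.eqb ?a ?b] => destruct (Nat.eqb_spec a b) end; lia.
  + pose proof (pent_lo_ge j). pose proof (pent_lo_lt_hi_lt_lo j). lia.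
  + intros i Hi. pose proof (pent_hi_lt_lo i j Hi).
    pose proof (pent_lo_lt_hi_lt_lo i). pose proof (pent_lo_lt_hi_lt_lo j). lia.
- rewrite shanks_sum_diag_S, IH. unfold indic.
  pose proof (pent_hi_lt_lo j n Hn).
  pose proof (pent_lo_lt_hi_lt_lo n). pose proof (pent_lo_lt_hi_lt_lo j).
  destruct (Nat.eqb_spec k (pent_lo n)); [lia|].
  destruct (Nat.eqb_spec k (pent_hi n)); [lia|]. lia.
Qed.

Lemma euler_coeff_pent (j k : nat) : k = pent_lo j \/ k = pent_hi j ->
  euler_coeff k = Zsign (S j).
Proof.
intros Hk. rewrite <- (shanks_sum_low k k k (le_n k)).
apply shanks_sum_diag_pent with (j := j); [exact Hk|].
pose proof (pent_lo_ge j). pose proof (pent_lo_lt_hi_lt_lo j). lia.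
Qed.

(** * Series supported on the pentagonal numbers *)

Fixpoint pent_sum (g : nat -> C) (m : nat) : C :=
  match m with
  | O => 0%C
  | S m' => (pent_sum g m' + IZR (Zsign m) * (g (pent_lo m') + g (pent_hi m')))%C
  end.

(** The last exponent used by [pent_sum g m], or [0] if there is none: from there up to [pent_lo m]
    the partial sums stay equal to [pent_sum g m]. *)
Definition pent_floor (m : nat) : nat :=
  match m with O => O | S m' => pent_hi m' end.

Lemma pent_mono (i j : nat) : (i <= j)%nat ->
  (pent_lo i <= pent_lo j /\ pent_hi i <= pent_hi j)%nat.
Proof.
intros H. destruct (Nat.eq_dec i j) as [->|Hij]; [lia|].
pose proof (pent_hi_lt_lo i j ltac:(lia)).
pose proof (pent_lo_lt_hi_lt_lo i). pose proof (pent_lo_lt_hi_lt_lo j). lia.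
Qed.

Lemma pent_hi_le_floor (i m : nat) : (i < m)%nat -> (pent_hi i <= pent_floor m)%nat.
Proof.
destruct m as [|m]; [lia|]. intros H; apply (pent_mono i m). lia.
Qed.

(** A partial sum in the order of increasing index may stop between the two members of a pair, hence
    the second alternative. *)
Lemma partial_sum_pent (g : nat -> C) (N : nat) : exists m,
  let P : C := sum_n (G := C_AbelianMonoid)
    (fun k => IZR (euler_coeff (S k)) * g (S k))%C N in
  ((pent_floor m <= S N < pent_lo m)%nat /\ P = pent_sum g m) \/
  ((pent_lo m <= S N < pent_hi m)%nat /\
    P = (pent_sum g m + IZR (Zsign (S m)) * g (pent_lo m))%C).
Proof.
induction N as [|N [m IH]].
(* The series starts at index 1, itself the first pentagonal number, so the first partial sum is
   already half a pair. *)
- exists 0%nat; cbv zeta. right. split; [cbv; lia|].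
  rewrite sum_O. rewrite (euler_coeff_pent 0 1) by (left; reflexivity).
  change (pent_lo 0) with 1%nat. cbn [pent_sum]. ring.
- cbv zeta in *. rewrite sum_Sn.
  remember (sum_n _ N) as P eqn:EP. clear EP.
  change (plus P ?x) with (Cplus P x).
  assert (Hz : (pent_floor m < S (S N))%nat -> S (S N) <> pent_lo m ->
    S (S N) <> pent_hi m -> (S (S N) < pent_hi m)%nat -> euler_coeff (S (S N)) = 0%Z).
  { intros H1 H2 H3 H4. apply euler_coeff_0; [lia|]. intros j.
    pose proof (pent_lo_lt_hi_lt_lo j). pose proof (pent_lo_lt_hi_lt_lo m).
    destruct (Nat.lt_trichotomy j m) as [Hj|[->|Hj]].
    - pose proof (pent_hi_le_floor j m Hj). lia.
    - lia.
    - pose proof (pent_hi_lt_lo m j Hj). lia. }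
  pose proof (pent_lo_lt_hi_lt_lo m) as T.
  assert (T' : (pent_floor m < pent_lo m)%nat).
  { destruct m as [|m]; [cbv; lia|]. apply pent_lo_lt_hi_lt_lo. }
  destruct IH as [[H ->]|[H ->]].
  + destruct (Nat.eq_dec (S (S N)) (pent_lo m)) as [E|E].
    * exists m; right. split; [lia|].
      rewrite (euler_coeff_pent m) by auto. now rewrite E.
    * exists m; left. split; [lia|]. rewrite Hz by lia. ring.
  + destruct (Nat.eq_dec (S (S N)) (pent_hi m)) as [E|E].
    * exists (S m); left. cbn [pent_floor]. split; [lia|].
      rewrite (euler_coeff_pent m) by auto. rewrite E. cbn [pent_sum]. ring.
    * exists m; right. split; [lia|]. rewrite Hz by lia. ring.
Qed.

(** Convergence over complete pairs does not control a partial sum ending in half a pair; the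
    condition on [g (pent_lo m)] does. *)
Lemma pent_series (g : nat -> C) (L : C) :
  (forall eps, 0 < eps -> exists M, forall m, (M <= m)%nat ->
    Cmod (pent_sum g m - L)%C < eps /\ Cmod (g (pent_lo m)) < eps) ->
  is_series (K := C_AbsRing) (V := C_NormedModule)
    (fun k => IZR (euler_coeff (S k)) * g (S k))%C L.
Proof.
intros H Q HQ. apply (locally_C L Q) in HQ. destruct HQ as [eps Heps].
destruct (H (eps / 2) ltac:(destruct eps; simpl; lra)) as [M HM].
exists (pent_hi M); intros N HN. apply Heps.
change (Cmod (sum_n (G := C_AbelianMonoid)
  (fun k => IZR (euler_coeff (S k)) * g (S k)) N - L)%C < eps).
destruct (partial_sum_pent g N) as [m Hm]. cbv zeta in Hm.
assert (HMm : (M <= m)%nat).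
{ destruct (Nat.le_gt_cases M m) as [h|h]; [exact h|].
  pose proof (pent_mono m M ltac:(lia)). pose proof (pent_lo_lt_hi_lt_lo m). lia. }
destruct (HM m HMm) as [H1 H2]. pose proof (Cmod_ge_0 (g (pent_lo m))).
destruct Hm as [[_ E]|[_ E]]; rewrite E; [lra|].
replace (pent_sum g m + IZR (Zsign (S m)) * g (pent_lo m) - L)%C with
  ((pent_sum g m - L) + IZR (Zsign (S m)) * g (pent_lo m))%C by ring.
eapply Rle_lt_trans; [apply Cmod_triangle|].
rewrite Cmod_mult, Cmod_R.
replace (Rabs (IZR (Zsign (S m)))) with 1; [lra|].
unfold Zsign; destruct Nat.even; simpl; unfold Rabs; destruct Rcase_abs; lra.
Qed.

(** * Complex differentiation *)

Notation is_Cderiv f z d :=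
  (is_derive (K := C_AbsRing) (V := AbsRing_NormedModule C_AbsRing) f z d).
Notation Ccontinuous f z :=
  (continuous (T := AbsRing_UniformSpace C_AbsRing)
     (U := AbsRing_UniformSpace C_AbsRing) f z).

Lemma is_Cderiv_eps (f : C -> C) (z d : C) :
  is_Cderiv f z d <->
  (forall eps, 0 < eps -> exists del, 0 < del /\
    forall w, Cmod w < del ->
      Cmod (f (z + w) - f z - d * w)%C <= eps * Cmod w).
Proof.
split.
- intros [_ H] eps Heps.
  destruct (H z (fun P HP => HP) (mkposreal eps Heps)) as [del Hdel].
  exists del; split; [apply cond_pos|]. intros w Hw.
  specialize (Hdel (z + w)%C).
  assert (E : minus (z + w)%C z = w).
  { change ((z + w) - z = w)%C. ring. }
  assert (B : ball (M := AbsRing_UniformSpace C_AbsRing) z del (z + w)%C).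
  { change (Cmod (minus (z + w)%C z) < del). rewrite E; exact Hw. }
  specialize (Hdel B).
  change (Cmod (f (z + w) - f z - (z + w - z) * d)%C <= eps * Cmod (z + w - z)%C)
    in Hdel.
  replace (z + w - z)%C with w in Hdel by ring.
  now rewrite (Cmult_comm d w).
- intros H; split; [apply is_linear_scal_l|].
  intros x Hx eps.
  assert (x = z) as ->.
  { symmetry; apply is_filter_lim_locally_unique, Hx. }
  destruct (H eps (cond_pos eps)) as [del [Hd Hdel]].
  exists (mkposreal del Hd); intros y Hy.
  specialize (Hdel (minus y z) Hy).
  assert (E : forall a b : C, (a + (b - a))%C = b) by (intros; ring).
  change (Cmod (f (z + (y - z)) - f z - d * (y - z))%C <= eps * Cmod (minus y z))
    in Hdel.
  rewrite E in Hdel.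
  change (Cmod (f y - f z - (minus y z) * d)%C <= eps * Cmod (minus y z)).
  now rewrite (Cmult_comm _ d).
Qed.

(** Two uniform structures on [C] are in play: discs for the differentiation rules, products of
    intervals for integrals along real paths. They have the same neighbourhoods. *)
Lemma Ccontinuous_pair (f : C -> C) (z : C) :
  Ccontinuous f z <->
  continuous (T := C_UniformSpace) (U := C_UniformSpace) f z.
Proof.
unfold continuous, filterlim, filter_le, filtermap. split; intros H P HP.
- apply (locally_C z (fun w => P (f w))), H. now apply (locally_C (f z) P).
- apply (locally_C z (fun w => P (f w))), H. now apply (locally_C (f z) P).
Qed.

Lemma Ccontinuous_eps (f : C -> C) (z : C) :
  Ccontinuous f z <->
  (forall eps, 0 < eps -> exists del, 0 < del /\
    forall w, Cmod w < del -> Cmod (f (z + w) - f z)%C < eps).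
Proof.
split.
- intros H eps Heps.
  destruct (H _ (locally_ball (T := AbsRing_UniformSpace C_AbsRing)
    (f z) (mkposreal eps Heps))) as [del Hdel].
  exists del; split; [apply cond_pos|]. intros w Hw.
  apply (Hdel (z + w)%C).
  change (Cmod ((z + w) - z)%C < del). now replace (z + w - z)%C with w by ring.
- intros H P [eps Heps].
  destruct (H eps (cond_pos eps)) as [del [Hd Hdel]].
  exists (mkposreal del Hd); intros y Hy. apply Heps.
  specialize (Hdel (y - z)%C Hy).
  assert (E : forall a b : C, (a + (b - a))%C = b) by (intros; ring).
  now rewrite E in Hdel.
Qed.


Lemma Ccontinuous_plus (f g : C -> C) (z : C) :
  Ccontinuous f z -> Ccontinuous g z -> Ccontinuous (fun w => f w + g w)%C z.
Proof.
exact (@continuous_plus (AbsRing_UniformSpace C_AbsRing) C_AbsRing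
  (AbsRing_NormedModule C_AbsRing) f g z).
Qed.

Lemma Ccontinuous_mult (f g : C -> C) (z : C) :
  Ccontinuous f z -> Ccontinuous g z -> Ccontinuous (fun w => f w * g w)%C z.
Proof. exact (@continuous_mult (AbsRing_UniformSpace C_AbsRing) C_AbsRing f g z). Qed.

Lemma Ccontinuous_comp (f g : C -> C) (z : C) :
  Ccontinuous f z -> Ccontinuous g (f z) -> Ccontinuous (fun w => g (f w)) z.
Proof.
exact (@continuous_comp (AbsRing_UniformSpace C_AbsRing)
  (AbsRing_UniformSpace C_AbsRing) (AbsRing_UniformSpace C_AbsRing) f g z).
Qed.

Lemma Ccontinuous_const (a z : C) : Ccontinuous (fun _ => a) z.
Proof.
exact (@continuous_const (AbsRing_UniformSpace C_AbsRing)
  (AbsRing_UniformSpace C_AbsRing) a z).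
Qed.

(** Continuity of the derivative is built in because vertical integrals are differentiated under the
    integral sign with respect to the abscissa. *)
Definition holo (U : C -> Prop) (f : C -> C) : Prop :=
  exists f' : C -> C, forall z, U z -> is_Cderiv f z (f' z) /\ Ccontinuous f' z.

Lemma Cderiv_continuous (f : C -> C) (z d : C) :
  is_Cderiv f z d -> Ccontinuous f z.
Proof.
intros H; apply (ex_derive_continuous (K := C_AbsRing)
  (V := AbsRing_NormedModule C_AbsRing)); now exists d.
Qed.

Lemma holo_continuous U (f : C -> C) z : holo U f -> U z -> Ccontinuous f z.
Proof.
intros [f' H] Hz. exact (Cderiv_continuous f z _ (proj1 (H z Hz))).
Qed.

Lemma holo_const U (a : C) : holo U (fun _ => a).
Proof.
exists (fun _ => 0%C); intros z _; split.
- apply (is_derive_const (K := C_AbsRing) (V := AbsRing_NormedModule C_AbsRing)).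
- apply Ccontinuous_const.
Qed.

Lemma holo_id U : holo U (fun z => z).
Proof.
exists (fun _ => 1%C); intros z _; split.
- apply (is_derive_id (K := C_AbsRing)).
- apply Ccontinuous_const.
Qed.

Lemma holo_plus U (f g : C -> C) : holo U f -> holo U g -> holo U (fun z => f z + g z)%C.
Proof.
intros [f' Hf] [g' Hg]; exists (fun z => f' z + g' z)%C; intros z Hz.
destruct (Hf z Hz) as [Hf1 Hf2], (Hg z Hz) as [Hg1 Hg2]; split.
- apply (is_derive_plus (K := C_AbsRing) (V := AbsRing_NormedModule C_AbsRing));
  assumption.
- now apply Ccontinuous_plus.
Qed.

Lemma holo_mult U (f g : C -> C) : holo U f -> holo U g -> holo U (fun z => f z * g z)%C.
Proof.
intros Hf0 Hg0; destruct (Hf0) as [f' Hf], (Hg0) as [g' Hg].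
exists (fun z => f' z * g z + f z * g' z)%C; intros z Hz.
destruct (Hf z Hz) as [Hf1 Hf2], (Hg z Hz) as [Hg1 Hg2]; split.
- apply (is_derive_mult (K := C_AbsRing)); [assumption..|exact Cmult_comm].
- apply Ccontinuous_plus; apply Ccontinuous_mult; try assumption;
  eapply holo_continuous; eassumption.
Qed.

Lemma holo_comp (U V : C -> Prop) (f g : C -> C) :
  (forall z, U z -> V (f z)) -> holo U f -> holo V g -> holo U (fun z => g (f z)).
Proof.
intros HUV Hf0 Hg0; destruct (Hf0) as [f' Hf], (Hg0) as [g' Hg].
exists (fun z => f' z * g' (f z))%C; intros z Hz.
destruct (Hf z Hz) as [Hf1 Hf2], (Hg (f z) (HUV z Hz)) as [Hg1 Hg2]; split.
- apply (is_derive_comp (K := C_AbsRing) (V := AbsRing_NormedModule C_AbsRing));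
  assumption.
- apply Ccontinuous_mult; [assumption|].
  apply Ccontinuous_comp; [|assumption].
  eapply holo_continuous; eassumption.
Qed.

Lemma is_Cderiv_inv (z : C) : z <> 0%C -> is_Cderiv Cinv z (- / (z * z))%C.
Proof.
intros Hz. assert (Hm : 0 < Cmod z) by now apply Cmod_gt_0.
apply is_Cderiv_eps; intros eps Heps.
(* The first bound keeps [Cmod (z + w)] above [Cmod z / 2]; the second then makes the error quotient
   [w / (z^2 (z + w))] at most [eps]. *)
exists (Rmin (Cmod z / 2) (eps * Cmod z ^ 3 / 2)); split.
{ apply Rmin_glb_lt; [lra|].
  apply Rdiv_lt_0_compat; [|lra]. apply Rmult_lt_0_compat; [lra|].
  now apply pow_lt. }
intros w Hw.
assert (H1 : Cmod w < Cmod z / 2)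
  by (eapply Rlt_le_trans; [exact Hw|apply Rmin_l]).
assert (H2 : Cmod w < eps * Cmod z ^ 3 / 2)
  by (eapply Rlt_le_trans; [exact Hw|apply Rmin_r]).
assert (H3 : Cmod z / 2 <= Cmod (z + w)%C).
{ pose proof (Cmod_triangle (z + w)%C (- w)%C) as T. rewrite Cmod_opp in T.
  replace (z + w + - w)%C with z in T by ring. lra. }
assert (Hzw : (z + w)%C <> 0%C) by (apply Cmod_gt_0; lra).
replace (/ (z + w) - / z - - / (z * z) * w)%C
  with (w * (w / (z * z * (z + w))))%C by (field; auto).
rewrite Cmod_mult, Rmult_comm.
apply Rmult_le_compat_r; [apply Cmod_ge_0|].
rewrite Cmod_div, !Cmod_mult; [|now repeat apply Cmult_neq_0].
apply Rmult_le_reg_r with (Cmod z * Cmod z * Cmod (z + w)%C).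
{ repeat apply Rmult_lt_0_compat; lra. }
unfold Rdiv; rewrite Rmult_assoc, Rinv_l.
2:{ apply Rgt_not_eq; repeat apply Rmult_lt_0_compat; lra. }
assert (eps * (Cmod z * Cmod z * (Cmod z / 2))
  <= eps * (Cmod z * Cmod z * Cmod (z + w)%C)).
{ apply Rmult_le_compat_l; [lra|]. apply Rmult_le_compat_l; [nra|lra]. }
nra.
Qed.

Lemma holo_inv U (f : C -> C) :
  (forall z, U z -> f z <> 0%C) -> holo U f -> holo U (fun z => / f z)%C.
Proof.
intros H0 Hf. apply (holo_comp U (fun z => z <> 0%C) f Cinv H0 Hf).
exists (fun z => - (1) * (/ z * / z))%C; intros z Hz.
assert (Hc : Ccontinuous Cinv z)
  by exact (Cderiv_continuous _ _ _ (is_Cderiv_inv z Hz)).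
split.
- replace (- (1) * (/ z * / z))%C with (- / (z * z))%C by (field; auto).
  now apply is_Cderiv_inv.
- apply Ccontinuous_mult; [apply Ccontinuous_const|now apply Ccontinuous_mult].
Qed.

Lemma Cexp_plus (a b : C) : Cexp (a + b)%C = (Cexp a * Cexp b)%C.
Proof.
destruct a as [a1 a2], b as [b1 b2]; unfold Cexp, Cplus, Cmult; simpl.
rewrite exp_plus, cos_plus, sin_plus; f_equal; ring.
Qed.

Lemma Cmod_Cexp (a : C) : Cmod (Cexp a) = exp (Re a).
Proof.
unfold Cmod, Cexp; simpl.
replace (_ + _)%R with (Rsqr (exp (Re a))).
- apply sqrt_Rsqr, Rlt_le, exp_pos.
- pose proof (sin2_cos2 (Im a)). unfold Rsqr in *.
  transitivity (exp (Re a) * exp (Re a) * (sin (Im a) * sin (Im a) + cos (Im a) * cos (Im a)));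
  [rewrite H|]; ring.
Qed.

Lemma Cmod_le_Rabs (a b : R) : Cmod (a, b) <= Rabs a + Rabs b.
Proof.
replace (a, b) with (RtoC a + Ci * RtoC b)%C
  by (unfold RtoC, Cplus, Cmult, Ci; simpl; f_equal; ring).
eapply Rle_trans; [apply Cmod_triangle|].
rewrite Cmod_mult, Cmod_Ci, !Cmod_R; lra.
Qed.

Lemma im_le_Cmod (z : C) : Rabs (Im z) <= Cmod z.
Proof.
eapply Rle_trans; [|apply Rmax_Cmod]. apply Rmax_r.
Qed.

(** * The complex exponential *)

(** The mean value theorem in the form that bootstraps: a bound on [sin] yields one on [cos - 1],
    and a bound on [cos - 1] yields one on [sin y - y]. *)
Lemma lipschitz_at_0 (f df : R -> R) (y M : R) :
  (forall t, is_derive f t (df t)) ->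
  (forall t, Rabs t <= Rabs y -> Rabs (df t) <= M) ->
  Rabs (f y - f 0) <= M * Rabs y.
Proof.
intros Hd Hb.
destruct (MVT_gen f 0 y df) as [t [Ht ->]].
- intros t _; apply Hd.
- intros t _. apply continuity_pt_filterlim.
  apply (ex_derive_continuous f t). now exists (df t).
- rewrite Rabs_mult, Rminus_0_r. apply Rmult_le_compat_r; [apply Rabs_pos|].
  apply Hb. revert Ht. unfold Rmin, Rmax.
  destruct (Rle_dec 0 y); intros; [rewrite !Rabs_pos_eq; lra|].
  rewrite !Rabs_left1; lra.
Qed.

Lemma Rabs_sin_le (y : R) : Rabs (sin y) <= Rabs y.
Proof.
pose proof (lipschitz_at_0 sin cos y 1 is_derive_sin) as H.
rewrite sin_0, Rminus_0_r, Rmult_1_l in H. apply H.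
intros t _. apply Rabs_le, COS_bound.
Qed.

Lemma Rabs_cos_minus_1_le (y : R) : Rabs (cos y - 1) <= Rabs y * Rabs y.
Proof.
pose proof (lipschitz_at_0 cos (fun t => - sin t) y (Rabs y) is_derive_cos) as H.
rewrite cos_0 in H. apply H.
intros t Ht. rewrite Rabs_Ropp. pose proof (Rabs_sin_le t). lra.
Qed.

Lemma Rabs_sin_minus_id_le (y : R) : Rabs (sin y - y) <= Rabs y * Rabs y.
Proof.
pose proof (lipschitz_at_0 (fun t => sin t - t) (fun t => cos t - 1) y (Rabs y)) as H.
cbv beta in H; rewrite sin_0, !Rminus_0_r in H. apply H.
- intros t. apply (is_derive_minus (K := R_AbsRing) (V := R_NormedModule)).
  apply is_derive_sin. apply (is_derive_id (K := R_AbsRing)).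
- intros t Ht.
  pose proof (lipschitz_at_0 cos (fun t => - sin t) t 1 is_derive_cos) as H'.
  rewrite cos_0 in H'.
  enough (Rabs (cos t - 1) <= 1 * Rabs t) by lra. apply H'.
  intros x _. rewrite Rabs_Ropp. apply Rabs_le, SIN_bound.
Qed.

Lemma Rabs_exp_minus_1_le (x : R) : Rabs (exp x - 1) <= Rabs x * exp (Rabs x).
Proof.
pose proof (exp_ineq1_le x). pose proof (exp_ineq1_le (- x)).
assert (exp x * exp (- x) = 1) by (rewrite <- exp_plus, Rplus_opp_r; apply exp_0).
pose proof (exp_pos x). pose proof (exp_pos (-x)).
destruct (Rle_dec 0 x).
- rewrite (Rabs_pos_eq x), Rabs_pos_eq; nra.
- rewrite (Rabs_left1 x), Rabs_left1; nra.
Qed.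

Lemma Rabs_exp_taylor1_le (x : R) :
  Rabs (exp x - 1 - x) <= Rabs x * Rabs x * exp (Rabs x).
Proof.
pose proof (exp_ineq1_le x). pose proof (exp_ineq1_le (- x)).
assert (exp x * exp (- x) = 1) by (rewrite <- exp_plus, Rplus_opp_r; apply exp_0).
pose proof (exp_pos x). pose proof (exp_pos (-x)).
assert (exp x * (1 - x) <= 1) by nra.
rewrite (Rabs_pos_eq (_ - _)) by lra.
destruct (Rle_dec 0 x).
- rewrite (Rabs_pos_eq x) by lra. nra.
- rewrite (Rabs_left1 x) by lra. nra.
Qed.

(** Splitting into real and imaginary parts leaves four remainders, each at most [m^2 exp m], so 5
    has slack. The bound is global in [w] because it is later used with [w] multiplied by the
    unbounded [ell]. *)
Lemma Cexp_taylor1_le (w : C) :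
  Cmod (Cexp w - 1 - w)%C <= 5 * (Cmod w * Cmod w) * exp (Cmod w).
Proof.
destruct w as [x y].
set (m := Cmod (x, y)).
assert (Hx : Rabs x <= m) by apply (re_le_Cmod (x, y)).
assert (Hy : Rabs y <= m) by apply (im_le_Cmod (x, y)).
replace (Cexp (x, y) - 1 - (x, y))%C with
  ((exp x * (cos y - 1) + (exp x - 1 - x))%R, (exp x * (sin y - y) + (exp x - 1) * y)%R)
  by (unfold Cexp, Cminus, Cplus, Copp, RtoC; simpl; f_equal; ring).
eapply Rle_trans; [apply Cmod_le_Rabs|].
pose proof (Rabs_triang (exp x * (cos y - 1)) (exp x - 1 - x)) as T1.
pose proof (Rabs_triang (exp x * (sin y - y)) ((exp x - 1) * y)) as T2.
rewrite Rabs_mult in T1; rewrite !Rabs_mult in T2.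
pose proof (Rabs_cos_minus_1_le y). pose proof (Rabs_sin_minus_id_le y).
pose proof (Rabs_exp_minus_1_le x). pose proof (Rabs_exp_taylor1_le x).
assert (He : exp (Rabs x) <= exp m) by (destruct Hx as [Hx| ->]; [left; now apply exp_increasing|right; reflexivity]).
assert (He' : Rabs (exp x) <= exp m).
{ rewrite Rabs_pos_eq by (left; apply exp_pos). eapply Rle_trans; [|exact He].
  destruct (Rle_abs x) as [h|h]; [left; now apply exp_increasing|rewrite <- h; lra]. }
pose proof (Rabs_pos x). pose proof (Rabs_pos y). pose proof (exp_pos m).
pose proof (Rabs_pos (cos y - 1)). pose proof (Rabs_pos (sin y - y)).
pose proof (Rabs_pos (exp x)). pose proof (Rabs_pos (exp x - 1)).
pose proof (exp_pos (Rabs x)).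
assert (Rabs x * Rabs x <= m * m) by nra.
assert (Rabs y * Rabs y <= m * m) by nra.
assert (Rabs x * Rabs y <= m * m) by nra.
assert (Rabs (exp x) * Rabs (cos y - 1) <= exp m * (m * m))
  by (apply Rmult_le_compat; lra).
assert (Rabs (exp x) * Rabs (sin y - y) <= exp m * (m * m))
  by (apply Rmult_le_compat; lra).
assert (Rabs x * Rabs x * exp (Rabs x) <= m * m * exp m)
  by (apply Rmult_le_compat; nra).
assert (Rabs (exp x - 1) * Rabs y <= (Rabs x * exp (Rabs x)) * Rabs y)
  by (apply Rmult_le_compat_r; lra).
assert (Rabs x * Rabs y * exp (Rabs x) <= m * m * exp m)
  by (apply Rmult_le_compat; nra).
nra.
Qed.

Lemma is_Cderiv_Cexp (z : C) : is_Cderiv Cexp z (Cexp z).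
Proof.
apply is_Cderiv_eps; intros eps Heps.
set (k := Cmod (Cexp z) * 5 * exp 1).
assert (Hk : 0 < k).
{ unfold k; rewrite Cmod_Cexp. pose proof (exp_pos (Re z)). pose proof (exp_pos 1).
  repeat apply Rmult_lt_0_compat; lra. }
exists (Rmin 1 (eps / k)); split.
{ apply Rmin_glb_lt; [lra|now apply Rdiv_lt_0_compat]. }
intros w Hw.
assert (H1 : Cmod w < 1) by (eapply Rlt_le_trans; [exact Hw|apply Rmin_l]).
assert (H2 : Cmod w < eps / k) by (eapply Rlt_le_trans; [exact Hw|apply Rmin_r]).
rewrite Cexp_plus.
replace (Cexp z * Cexp w - Cexp z - Cexp z * w)%C
  with (Cexp z * (Cexp w - 1 - w))%C by ring.
rewrite Cmod_mult.
pose proof (Cexp_taylor1_le w) as T.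
assert (He : exp (Cmod w) <= exp 1) by (left; now apply exp_increasing).
pose proof (Cmod_ge_0 w). pose proof (Cmod_ge_0 (Cexp z)).
assert (H3 : Cmod w * k <= eps).
{ apply Rmult_le_reg_r with (/ k); [now apply Rinv_0_lt_compat|].
  rewrite Rmult_assoc, Rinv_r by lra. lra. }
assert (Cmod (Cexp w - 1 - w)%C <= 5 * (Cmod w * Cmod w) * exp 1).
{ eapply Rle_trans; [exact T|]. apply Rmult_le_compat_l; nra. }
apply Rle_trans with (Cmod w * k * Cmod w); [unfold k|].
- replace (Cmod w * (Cmod (Cexp z) * 5 * exp 1) * Cmod w)
    with (Cmod (Cexp z) * (5 * (Cmod w * Cmod w) * exp 1)) by ring.
  now apply Rmult_le_compat_l.
- now apply Rmult_le_compat_r.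
Qed.

Lemma holo_Cexp U : holo U Cexp.
Proof.
exists Cexp; intros z _; split; [apply is_Cderiv_Cexp|].
exact (Cderiv_continuous _ _ _ (is_Cderiv_Cexp z)).
Qed.

(** * The logarithm of [u] *)

Lemma Clog_Cexp (w : C) : - PI < Im w <= PI -> Clog (Cexp w) = w.
Proof.
intros Hw. unfold Clog. rewrite Cmod_Cexp, ln_exp.
enough (Carg (Cexp w) = Im w) as -> by (destruct w; reflexivity).
unfold Carg. rewrite Cmod_Cexp.
pose proof (exp_pos (Re w)) as He.
replace (Re (Cexp w) / exp (Re w)) with (cos (Im w))
  by (unfold Cexp; simpl; field; lra).
change (Im (Cexp w)) with (exp (Re w) * sin (Im w)).
destruct (Rle_dec 0 (Im w)) as [H0|H0].
- assert (0 <= sin (Im w)) by (apply sin_ge_0; lra).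
  destruct Rle_dec as [_|n]; [|exfalso; apply n; nra].
  apply acos_cos; lra.
- assert (0 < sin (- Im w)) by (apply sin_gt_0; lra).
  rewrite sin_neg in H.
  destruct Rle_dec as [r|_]; [exfalso; nra|].
  rewrite <- cos_neg, acos_cos; lra.
Qed.

(** Agrees with [Clog] where [0 < Re z], but is visibly continuous there;
    only used on that half-plane. *)
Definition Lg (z : C) : C := (ln (Cmod z), atan (Im z / Re z)).

Lemma Cexp_Lg (z : C) : 0 < Re z -> Cexp (Lg z) = z.
Proof.
intros Hz. assert (Hm : 0 < Cmod z).
{ eapply Rlt_le_trans; [exact Hz|].
  eapply Rle_trans; [apply Rle_abs|apply re_le_Cmod]. }
assert (E : Cmod z = Re z * sqrt (1 + Rsqr (Im z / Re z))).
{ rewrite <- (sqrt_Rsqr (Re z)) at 1 by lra.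
  rewrite <- sqrt_mult_alt by apply Rle_0_sqr.
  unfold Cmod; f_equal. destruct z as [a b]; unfold Rsqr; simpl in *; field; lra. }
assert (Hs : 0 < sqrt (1 + Rsqr (Im z / Re z))).
{ apply sqrt_lt_R0. pose proof (Rle_0_sqr (Im z / Re z)); lra. }
unfold Cexp, Lg; simpl. rewrite exp_ln by exact Hm.
rewrite cos_atan, sin_atan, E.
destruct z as [a b]; simpl in *; f_equal; field; lra.
Qed.

Lemma Ccontinuous_Lg (z : C) : 0 < Re z -> Ccontinuous Lg z.
Proof.
intros Hz. apply Ccontinuous_pair. unfold Lg.
assert (Hm : 0 < Cmod z).
{ eapply Rlt_le_trans; [exact Hz|].
  eapply Rle_trans; [apply Rle_abs|apply re_le_Cmod]. }
assert (HRe : continuous (T := C_UniformSpace) (U := R_UniformSpace) Re z)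
  by (destruct z; apply (continuous_fst (U := R_UniformSpace))).
assert (HIm : continuous (T := C_UniformSpace) (U := R_UniformSpace) Im z)
  by (destruct z; apply (continuous_snd (V := R_UniformSpace))).
apply (continuous_comp_2 (V := R_UniformSpace) (W := R_UniformSpace)
  (X := C_UniformSpace) (fun z : C_UniformSpace => ln (Cmod z))
  (fun z : C_UniformSpace => atan (Im z / Re z)) (fun a b => (a, b))).
- apply (continuous_comp (V := R_UniformSpace) Cmod ln).
  + exact (filterlim_norm (K := C_AbsRing) (V := C_NormedModule) z).
  + apply (ex_derive_continuous ln). exists (/ Cmod z). now apply is_derive_ln.
- apply (continuous_comp (V := R_UniformSpace) (fun z : C => Im z / Re z) atan).
  + apply (continuous_mult (K := R_AbsRing)); [exact HIm|].
    apply (continuous_comp Re Rinv); [exact HRe|].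
    apply continuous_Rinv. lra.
  + apply (ex_derive_continuous atan). eexists. apply is_derive_atan.
- apply continuous_ext with (f := fun x => x); [now intros []|apply continuous_id].
Qed.

(** The increment [k] of [Lg] satisfies [Cexp k = 1 + w / z], so [k - w / z] is quadratic in [k] by
    the Taylor bound. Continuity makes [k] small, and then [k] is at most twice [w / z] in
    modulus. *)
Lemma is_Cderiv_Lg (z : C) : 0 < Re z -> is_Cderiv Lg z (/ z)%C.
Proof.
intros Hz. assert (Hm : 0 < Cmod z).
{ eapply Rlt_le_trans; [exact Hz|].
  eapply Rle_trans; [apply Rle_abs|apply re_le_Cmod]. }
assert (Hz0 : z <> 0%C) by now apply Cmod_gt_0.
apply is_Cderiv_eps; intros eps Heps.
pose proof (exp_pos 1) as He.
(* The three bounds on [k] serve to replace [exp (Cmod k)] by [exp 1], to make the quadratic term at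
   most [Cmod k / 2], and to bring the final error below [eps]. *)
set (b := Rmin 1 (Rmin (/ (10 * exp 1)) (eps * Cmod z / (10 * exp 1)))).
assert (Hb : 0 < b).
{ repeat apply Rmin_glb_lt; [lra|apply Rinv_0_lt_compat; lra|].
  apply Rdiv_lt_0_compat; nra. }
destruct (proj1 (Ccontinuous_eps Lg z) (Ccontinuous_Lg z Hz) b Hb) as [del [Hd Hc]].
exists (Rmin del (Re z)); split; [now apply Rmin_glb_lt|].
intros w Hw.
assert (Hw1 : Cmod w < del) by (eapply Rlt_le_trans; [exact Hw|apply Rmin_l]).
assert (Hw2 : Cmod w < Re z) by (eapply Rlt_le_trans; [exact Hw|apply Rmin_r]).
assert (Hzw : 0 < Re (z + w)%C).
{ pose proof (re_le_Cmod w) as T. apply Rabs_le_between in T.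
  change (0 < Re z + Re w). lra. }
specialize (Hc w Hw1). set (k := (Lg (z + w) - Lg z)%C) in *.
assert (B1 : Cmod k < 1) by (eapply Rlt_le_trans; [exact Hc|apply Rmin_l]).
assert (B2 : 10 * exp 1 * Cmod k <= 1).
{ apply Rmult_le_reg_l with (/ (10 * exp 1)); [apply Rinv_0_lt_compat; lra|].
  rewrite <- Rmult_assoc, Rinv_l, Rmult_1_l, Rmult_1_r by lra.
  left; eapply Rlt_le_trans; [exact Hc|].
  eapply Rle_trans; [apply Rmin_r|apply Rmin_l]. }
assert (B3 : 10 * exp 1 * Cmod k <= eps * Cmod z).
{ apply Rmult_le_reg_l with (/ (10 * exp 1)); [apply Rinv_0_lt_compat; lra|].
  rewrite <- Rmult_assoc, Rinv_l, Rmult_1_l by lra.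
  left; eapply Rlt_le_trans; [exact Hc|].
  eapply Rle_trans; [apply Rmin_r|].
  eapply Rle_trans; [apply Rmin_r|]. right; unfold Rdiv; ring. }
assert (Ek : Cexp k = (1 + w / z)%C).
{ assert (Cexp (Lg z + k)%C = z + w)%C.
  { replace (Lg z + k)%C with (Lg (z + w)%C) by (unfold k; ring).
    now apply Cexp_Lg. }
  rewrite Cexp_plus, Cexp_Lg in H by assumption.
  replace (Cexp k) with (z * Cexp k / z)%C by (field; exact Hz0).
  rewrite H. field. exact Hz0. }
pose proof (Cexp_taylor1_le k) as T.
rewrite Ek in T. replace (1 + w / z - 1 - k)%C with (- (k - / z * w))%C in T by (field; exact Hz0).
rewrite Cmod_opp in T.
pose proof (Cmod_ge_0 k) as Pk.
assert (He1 : exp (Cmod k) <= exp 1) by (left; now apply exp_increasing).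
assert (T' : Cmod (k - / z * w)%C <= 5 * exp 1 * Cmod k * Cmod k) by nra.
assert (Q : Cmod k <= Cmod (k - / z * w)%C + / Cmod z * Cmod w).
{ rewrite <- (Cmod_inv z), <- Cmod_mult by assumption.
  replace k with ((k - / z * w) + / z * w)%C at 1 by ring. apply Cmod_triangle. }
assert (Q2 : Cmod k <= 2 * (/ Cmod z * Cmod w)) by nra.
eapply Rle_trans; [exact T'|].
assert (Q3 : Cmod z * Cmod k <= 2 * Cmod w).
{ apply Rmult_le_compat_l with (r := Cmod z) in Q2; [|lra].
  replace (Cmod z * (2 * (/ Cmod z * Cmod w))) with (2 * Cmod w) in Q2
    by (field; lra). exact Q2. }
apply Rmult_le_reg_l with (Cmod z); [exact Hm|].
pose proof (Cmod_ge_0 w).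
apply Rle_trans with (5 * exp 1 * Cmod k * (2 * Cmod w)).
- replace (Cmod z * (5 * exp 1 * Cmod k * Cmod k))
    with (5 * exp 1 * Cmod k * (Cmod z * Cmod k)) by ring.
  apply Rmult_le_compat_l; [nra|exact Q3].
- replace (5 * exp 1 * Cmod k * (2 * Cmod w))
    with (10 * exp 1 * Cmod k * Cmod w) by ring.
  replace (Cmod z * (eps * Cmod w)) with (eps * Cmod z * Cmod w) by ring.
  now apply Rmult_le_compat_r.
Qed.

Lemma holo_Lg : holo (fun z => 0 < Re z) Lg.
Proof.
exists Cinv; intros z Hz; split; [now apply is_Cderiv_Lg|].
apply (Cderiv_continuous _ _ (- / (z * z))%C), is_Cderiv_inv.
intros ->. simpl in Hz; lra.
Qed.

Definition ell (z : C) : C :=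
  (Lg (PI - 3 * z) + Lg (2 * PI - 3 * z) + - RtoC (ln (6 * PI ^ 2)))%C.

Definition left_plane (z : C) : Prop := Re z < PI / 3.

Lemma left_plane_Re (z : C) :
  left_plane z -> 0 < Re (PI - 3 * z)%C /\ 0 < Re (2 * PI - 3 * z)%C.
Proof.
unfold left_plane; destruct z as [a b]; simpl; intros H.
pose proof PI_RGT_0. split; lra.
Qed.

(** The two arguments lie strictly between [- PI / 2] and [PI / 2], so their sum stays in the
    principal range and no multiple of [2 PI] has to be corrected. *)
Lemma Clog_u (z : C) : left_plane z -> Clog (u z) = ell z.
Proof.
intros Hz. destruct (left_plane_Re z Hz) as [H1 H2].
assert (H6 : 0 < 6 * PI ^ 2).
{ pose proof PI_RGT_0. pose proof (pow_lt PI 2 H). lra. }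
assert (E : u z = Cexp (ell z)).
{ unfold ell. rewrite !Cexp_plus, !Cexp_Lg by assumption.
  unfold u, Cdiv; f_equal.
  unfold Cexp, RtoC, Copp; simpl.
  rewrite Ropp_0, sin_0, cos_0, exp_Ropp, exp_ln by (simpl in H6; exact H6).
  rewrite Rmult_0_r, Rmult_1_r. pose proof PI_neq0. unfold Cinv, Cmult; simpl.
  f_equal; field; repeat split; auto; nra. }
rewrite E. apply Clog_Cexp.
unfold ell, Lg; simpl.
match goal with |- _ < atan ?a + atan ?b + _ <= _ =>
  pose proof (atan_bound a); pose proof (atan_bound b) end.
lra.
Qed.

Lemma holo_ell : holo left_plane ell.
Proof.
assert (Haff : forall a : C, holo left_plane (fun z => a - 3 * z)%C).
{ intros a. apply holo_plus; [apply holo_const|].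
  destruct (holo_mult left_plane (fun _ => - (3))%C (fun z => z)
    (holo_const _ _) (holo_id _)) as [f' Hf].
  exists f'; intros z Hz. destruct (Hf z Hz) as [D C]; split; [|exact C].
  revert D; apply is_derive_ext; intros t.
  change (- (3) * t = - (3 * t))%C. ring. }
unfold ell; apply holo_plus; [apply holo_plus|].
- apply (holo_comp _ (fun z => 0 < Re z) (fun z => PI - 3 * z)%C Lg);
  [intros z Hz; now apply left_plane_Re|apply Haff|apply holo_Lg].
- apply (holo_comp _ (fun z => 0 < Re z) (fun z => 2 * PI - 3 * z)%C Lg);
  [intros z Hz; now apply left_plane_Re|apply Haff|apply holo_Lg].
- apply holo_const.
Qed.

Lemma ln_le_linear (eps : R) : 0 < eps ->
  exists B, forall x, 0 < x -> ln x <= B + eps * x.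
Proof.
intros He. exists (- ln eps); intros x Hx.
assert (0 < eps * x) by nra.
pose proof (exp_ineq1_le (ln (eps * x))) as H1.
rewrite exp_ln in H1 by assumption. rewrite ln_mult in H1 by assumption. lra.
Qed.

Lemma Cmod_Lg_le (eps r : R) : 0 < eps -> 0 < r ->
  exists B, forall z, r <= Re z -> Cmod (Lg z) <= B + eps * Cmod z.
Proof.
intros He Hr. destruct (ln_le_linear eps He) as [B HB].
exists (Rabs B + Rabs (ln r) + PI); intros z Hz.
assert (Hm : r <= Cmod z).
{ eapply Rle_trans; [exact Hz|].
  eapply Rle_trans; [apply Rle_abs|apply re_le_Cmod]. }
unfold Lg. eapply Rle_trans; [apply Cmod_le_Rabs|].
assert (Rabs (atan (Im z / Re z)) <= PI).
{ pose proof (atan_bound (Im z / Re z)). pose proof PI_RGT_0. apply Rabs_le; lra. }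
enough (Rabs (ln (Cmod z)) <= Rabs B + Rabs (ln r) + eps * Cmod z) by lra.
pose proof (HB (Cmod z) ltac:(lra)).
pose proof (ln_le r (Cmod z) Hr Hm).
pose proof (Rle_abs B). pose proof (Rle_abs (- ln r)). rewrite Rabs_Ropp in *.
pose proof (Rabs_pos B). pose proof (Rabs_pos (ln r)).
apply Rabs_le; split; nra.
Qed.

(** Logarithmic growth is beaten by any linear function. With [A = Cmod s] this bounds every power
    of [u] by a constant times [exp (|y| / 2)], uniformly in a strip. *)
Lemma Cmod_ell_le (A a b : R) : 0 <= A -> b < PI / 3 ->
  exists B, forall x y, a <= x <= b -> A * Cmod (ell (x, y)) <= B + Rabs y / 2.
Proof.
intros HA Hb.
(* The two logarithms, each of an argument growing like [3 |y|], contribute a slope of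
   [6 A / (12 (A + 1))], which is below one half. *)
assert (He : 0 < / (12 * (A + 1))) by (apply Rinv_0_lt_compat; lra).
destruct (Cmod_Lg_le _ (PI - 3 * b) He ltac:(lra)) as [B HB].
set (M := Rabs (2 * PI) + 3 * (Rabs a + Rabs b)).
exists (A * (2 * B + 2 * (/ (12 * (A + 1)) * M) + Rabs (ln (6 * PI ^ 2)))).
intros x y Hx. pose proof PI_RGT_0 as HPI.
assert (Hlin : forall p, 0 <= p <= 2 * PI -> Cmod (p - 3 * (x, y))%C <= M + 3 * Rabs y).
{ intros p Hp.
  replace (p - 3 * (x, y))%C with ((p - 3 * x)%R, (- (3 * y))%R)
    by (unfold RtoC, Cminus, Cplus, Copp, Cmult; simpl; f_equal; ring).
  eapply Rle_trans; [apply Cmod_le_Rabs|].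
  rewrite Rabs_Ropp, Rabs_mult, (Rabs_pos_eq 3) by lra.
  apply Rplus_le_compat_r. unfold M.
  assert (Rabs x <= Rabs a + Rabs b).
  { apply Rabs_le; unfold Rabs; destruct (Rcase_abs a), (Rcase_abs b); lra. }
  apply Rabs_le_between in H.
  rewrite (Rabs_pos_eq (2 * PI)) by lra.
  apply Rabs_le; lra. }
assert (T : Cmod (ell (x, y)) <= 2 * B + / (12 * (A + 1)) * (2 * (M + 3 * Rabs y))
  + Rabs (ln (6 * PI ^ 2))).
{ unfold ell. eapply Rle_trans; [apply Cmod_triangle|]. rewrite Cmod_opp, Cmod_R.
  apply Rplus_le_compat_r.
  eapply Rle_trans; [apply Cmod_triangle|].
  pose proof (HB (PI - 3 * (x, y))%C ltac:(simpl; lra)) as H1.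
  pose proof (HB (2 * PI - 3 * (x, y))%C ltac:(simpl; lra)) as H2.
  pose proof (Hlin PI ltac:(lra)) as H3.
  pose proof (Hlin (2 * PI) ltac:(lra)) as H4. rewrite RtoC_mult in H4.
  apply Rmult_le_compat_l with (r := / (12 * (A + 1))) in H3; [|lra].
  apply Rmult_le_compat_l with (r := / (12 * (A + 1))) in H4; [|lra].
  lra. }
apply Rmult_le_compat_l with (r := A) in T; [|exact HA].
eapply Rle_trans; [exact T|].
enough (A * / (12 * (A + 1)) * 6 * Rabs y <= Rabs y / 2) by nra.
assert (A * / (12 * (A + 1)) <= / 12).
{ apply Rmult_le_reg_r with (12 * (A + 1)); [lra|].
  rewrite Rmult_assoc, Rinv_l by lra. lra. }
pose proof (Rabs_pos y). nra.
Qed.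

(** * Integrals of complex functions over a line *)

Notation CRInt f a b := (RInt (V := C_R_CompleteNormedModule) f a b).
Notation is_CRInt f a b l := (is_RInt (V := C_R_NormedModule) f a b l).
Notation ex_CRInt f a b := (ex_RInt (V := C_R_NormedModule) f a b).
Notation path_continuous f t :=
  (continuous (T := R_UniformSpace) (U := C_UniformSpace) f t).

Lemma ex_CRInt_continuous (f : R -> C) (a b : R) :
  (forall t, path_continuous f t) -> ex_CRInt f a b.
Proof.
intros H. apply (ex_RInt_continuous (V := C_R_CompleteNormedModule)).
intros t _. apply H.
Qed.

Lemma CRInt_correct (f : R -> C) (a b : R) :
  ex_CRInt f a b -> is_CRInt f a b (CRInt f a b).
Proof. exact (RInt_correct (V := C_R_CompleteNormedModule) f a b). Qed.

Lemma CRInt_unique (f : R -> C) (a b : R) (l : C) :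
  is_CRInt f a b l -> CRInt f a b = l.
Proof. exact (is_RInt_unique (V := C_R_CompleteNormedModule) f a b l). Qed.

Lemma is_CRInt_pair (f : R -> C) (a b : R) (l : C) :
  is_CRInt f a b l <->
  is_RInt (V := R_NormedModule) (fun t => Re (f t)) a b (Re l) /\
  is_RInt (V := R_NormedModule) (fun t => Im (f t)) a b (Im l).
Proof.
split.
- intros H; split.
  + exact (is_RInt_fct_extend_fst (U := R_NormedModule) (V := R_NormedModule) f a b l H).
  + exact (is_RInt_fct_extend_snd (U := R_NormedModule) (V := R_NormedModule) f a b l H).
- intros [H1 H2]. destruct l as [l1 l2].
  exact (is_RInt_fct_extend_pair (U := R_NormedModule) (V := R_NormedModule) f a b l1 l2 H1 H2).
Qed.

Lemma is_CRInt_Cmult (c : C) (f : R -> C) (a b : R) (l : C) :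
  is_CRInt f a b l -> is_CRInt (fun t => c * f t)%C a b (c * l)%C.
Proof.
rewrite !is_CRInt_pair; intros [H1 H2]; split; simpl.
- apply (is_RInt_minus (V := R_NormedModule));
  apply (is_RInt_scal (V := R_NormedModule)); assumption.
- apply (is_RInt_plus (V := R_NormedModule));
  apply (is_RInt_scal (V := R_NormedModule)); assumption.
Qed.

Lemma Cmod_CRInt_le (f : R -> C) (g : R -> R) (a b : R) (l : C) (lg : R) :
  a <= b -> (forall t, a <= t <= b -> Cmod (f t) <= g t) ->
  is_CRInt f a b l -> is_RInt g a b lg -> Cmod l <= lg.
Proof.
intros Hab Hb Hf Hg. rewrite Cmod_norm.
refine (norm_RInt_le (V := C_R_NormedModule) f g a b l lg Hab _ Hf Hg).
intros t Ht. specialize (Hb t Ht). now rewrite Cmod_norm in Hb.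
Qed.

Lemma Cmod_CRInt_le_const (f : R -> C) (M a b : R) :
  a <= b -> (forall t, a <= t <= b -> Cmod (f t) <= M) ->
  ex_CRInt f a b -> Cmod (CRInt f a b) <= (b - a) * M.
Proof.
intros Hab Hb Hf.
refine (Cmod_CRInt_le f (fun _ => M) a b _ _ Hab Hb (CRInt_correct f a b Hf) _).
exact (is_RInt_const (V := R_NormedModule) a b M).
Qed.

Lemma CRInt_Chasles (f : R -> C) (a b c : R) :
  ex_CRInt f a b -> ex_CRInt f b c ->
  (CRInt f a b + CRInt f b c)%C = CRInt f a c.
Proof. exact (RInt_Chasles (V := C_R_CompleteNormedModule) f a b c). Qed.

(** The rate [1 / 2] is what remains of the decay [exp (- |t|)] of [F] after the growth
    [exp (|t| / 2)] conceded to the power of [u]. *)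
Definition exp_bounded (K : R) (f : R -> C) : Prop :=
  (forall t, path_continuous f t) /\
  (forall t, Cmod (f t) <= K * exp (- (Rabs t / 2))).

Lemma exp_bounded_pos K f : exp_bounded K f -> 0 <= K.
Proof.
intros [_ H]. specialize (H 0). pose proof (Cmod_ge_0 (f 0)).
pose proof (exp_pos (- (Rabs 0 / 2))). nra.
Qed.

Lemma CRInt_tail_pos K f a b : exp_bounded K f -> 0 <= a <= b ->
  Cmod (CRInt f a b) <= 2 * K * exp (- (a / 2)).
Proof.
intros HK Hab. pose proof (exp_bounded_pos K f HK) as K0. destruct HK as [Hc Hb].
apply Rle_trans with (- (2 * K) * exp (- (b / 2)) - - (2 * K) * exp (- (a / 2))).
2:{ pose proof (exp_pos (- (b / 2))). nra. }
refine (Cmod_CRInt_le f (fun t => K * exp (- (t / 2))) a b _ _ (proj2 Hab) _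
  (CRInt_correct f a b (ex_CRInt_continuous f a b Hc)) _).
- intros t Ht. rewrite <- (Rabs_pos_eq t) at 2 by lra. apply Hb.
- apply (is_RInt_derive (V := R_CompleteNormedModule) (fun t => - (2 * K) * exp (- (t / 2)))).
  + intros t _. auto_derive; [exact I|]. unfold Rdiv; field.
  + intros t _. apply (ex_derive_continuous (fun t => K * exp (- (t / 2)))).
    auto_derive; exact I.
Qed.

Lemma CRInt_tail_neg K f a b : exp_bounded K f -> 0 <= a <= b ->
  Cmod (CRInt f (- b) (- a)) <= 2 * K * exp (- (a / 2)).
Proof.
intros HK Hab. pose proof (exp_bounded_pos K f HK) as K0. destruct HK as [Hc Hb].
apply Rle_trans with (2 * K * exp (- a / 2) - 2 * K * exp (- b / 2)).
2:{ pose proof (exp_pos (- b / 2)). replace (- (a / 2)) with (- a / 2) by field. nra. }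
refine (Cmod_CRInt_le f (fun t => K * exp (t / 2)) (- b) (- a) _ _ ltac:(lra) _
  (CRInt_correct f _ _ (ex_CRInt_continuous f _ _ Hc)) _).
- intros t Ht. specialize (Hb t). rewrite Rabs_left1 in Hb by lra.
  now replace (- (- t / 2)) with (t / 2) in Hb by field.
- apply (is_RInt_derive (V := R_CompleteNormedModule) (fun t => 2 * K * exp (t / 2))).
  + intros t _. auto_derive; [exact I|]. unfold Rdiv; field.
  + intros t _. apply (ex_derive_continuous (fun t => K * exp (t / 2))).
    auto_derive; exact I.
Qed.

Lemma exp_tail_small (K eps : R) : 0 <= K -> 0 < eps ->
  exists T, 0 <= T /\ 2 * K * exp (- (T / 2)) < eps.
Proof.
intros HK He. exists (4 * K / eps).
assert (Hx : 0 <= 4 * K / eps) by (apply Rdiv_le_0_compat; lra).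
split; [exact Hx|].
rewrite exp_Ropp.
pose proof (exp_ineq1_le (4 * K / eps / 2)) as H.
apply Rmult_lt_reg_r with (exp (4 * K / eps / 2)); [apply exp_pos|].
rewrite Rmult_assoc, Rinv_l, Rmult_1_r by (apply Rgt_not_eq, exp_pos).
apply Rlt_le_trans with (eps * (1 + 4 * K / eps / 2)); [|apply Rmult_le_compat_l; lra].
replace (eps * (1 + 4 * K / eps / 2)) with (eps + 2 * K) by (field; lra). lra.
Qed.

Lemma ball_Cmod (a b : C) (eps : R) : Cmod (b - a)%C < eps ->
  ball (M := C_UniformSpace) a eps b.
Proof. intros H. apply (C_NormedModule_mixin_compat1 a b eps H). Qed.

(** The exponential tails give Cauchy's criterion; the disjunction on the filter lets one argument
    serve both ends of the line. *)
Lemma filterlim_CRInt (K : R) (f : R -> C) (F : (R -> Prop) -> Prop) :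
  ProperFilter F -> exp_bounded K f ->
  (forall T, F (fun t => T < t)) \/ (forall T, F (fun t => t < - T)) ->
  exists l, is_RInt_gen (V := C_R_NormedModule) f (at_point 0) F l.
Proof.
intros PF HK HF.
pose proof (exp_bounded_pos K f HK) as K0.
assert (Hex : forall a b, ex_CRInt f a b)
  by (intros; apply ex_CRInt_continuous, HK).
assert (Hsub : forall u v, (CRInt f 0 v - CRInt f 0 u)%C = CRInt f u v).
{ intros u v. rewrite <- (CRInt_Chasles f 0 u v) by apply Hex.
  ring. }
assert (Hswap : forall u v, Cmod (CRInt f u v) = Cmod (CRInt f v u)).
{ intros u v. rewrite <- (Hsub u v), <- (Hsub v u), <- Cmod_opp. f_equal; ring. }
destruct (proj1 (filterlim_locally_cauchy (U := C_R_CompleteNormedModule)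
  (F := F) (fun t => CRInt f 0 t))) as [l Hl].
{ intros eps. destruct (exp_tail_small K eps K0 (cond_pos eps)) as [T [HT0 HT]].
  assert (Hmono : forall t, T <= t -> 2 * K * exp (- (t / 2)) < eps).
  { intros t Ht. eapply Rle_lt_trans; [|exact HT].
    apply Rmult_le_compat_l; [lra|].
    destruct Ht as [Ht| ->]; [left; apply exp_increasing; lra|lra]. }
  destruct HF as [HF|HF].
  - exists (fun t => T < t); split; [apply HF|]. intros v w Hv Hw.
    apply ball_Cmod. rewrite Hsub.
    destruct (Rle_dec v w); [|rewrite Hswap];
    (eapply Rle_lt_trans; [apply (CRInt_tail_pos K)|apply Hmono]; auto; lra).
  - exists (fun t => t < - T); split; [apply HF|]. intros v w Hv Hw.
    apply ball_Cmod. rewrite Hsub, <- (Ropp_involutive v), <- (Ropp_involutive w).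
    destruct (Rle_dec v w); [|rewrite Hswap];
    (eapply Rle_lt_trans; [apply (CRInt_tail_neg K)|apply Hmono]; auto; lra). }
exists l. intros P HP. specialize (Hl P HP).
unfold filtermapi, filtermap in *.
apply (Filter_prod _ _ _ (fun t => t = 0) (fun t => P (CRInt f 0 t))); [reflexivity|exact Hl|].
intros x y -> Hy. exists (CRInt f 0 y). split; [apply CRInt_correct, Hex|exact Hy].
Qed.

Notation is_line_int f l :=
  (is_RInt_gen (V := C_R_NormedModule) f
    (Rbar_locally m_infty) (Rbar_locally p_infty) l).

Lemma ex_line_int (K : R) (f : R -> C) : exp_bounded K f -> exists l, is_line_int f l.
Proof.
intros HK.
destruct (filterlim_CRInt K f (Rbar_locally m_infty) _ HK) as [l1 H1].
{ right; intros T; now exists (- T). }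
destruct (filterlim_CRInt K f (Rbar_locally p_infty) _ HK) as [l2 H2].
{ left; intros T; now exists T. }
exists (plus (opp l1) l2).
apply (is_RInt_gen_Chasles f 0); [|exact H2].
now apply is_RInt_gen_swap.
Qed.

(** Symmetric segments suit both the rectangles used to move a line and the parity argument on
    [Re z = - PI / 2]. The definition does not assert integrability, so the algebraic rules for it
    ask for continuity. *)
Definition sym_lim (f : R -> C) (l : C) : Prop :=
  forall eps, 0 < eps -> exists T0, forall T, T0 < T ->
    Cmod (CRInt f (- T) T - l)%C < eps.

Lemma line_int_sym_lim (f : R -> C) (l : C) : is_line_int f l -> sym_lim f l.
Proof.
intros H eps Heps.
destruct (H (fun w => Cmod (w - l)%C < eps)) as [P Q [M1 HP] [M2 HQ] HPQ].
{ apply (locally_C l (fun w => Cmod (w - l)%C < eps)).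
  now exists (mkposreal eps Heps). }
exists (Rmax (- M1) M2); intros T HT.
destruct (HPQ (- T) T) as [y [Hy1 Hy2]].
- apply HP. pose proof (Rmax_l (- M1) M2). lra.
- apply HQ. pose proof (Rmax_r (- M1) M2). lra.
- simpl in Hy1. now rewrite (CRInt_unique f (- T) T y Hy1).
Qed.

Lemma sym_lim_unique (f : R -> C) (l l' : C) : sym_lim f l -> sym_lim f l' -> l = l'.
Proof.
intros H H'. destruct (Ceq_dec l l') as [E|E]; [exact E|exfalso].
assert (Hm : 0 < Cmod (l - l')%C).
{ apply Cmod_gt_0. intros E'. apply E. replace l with ((l - l') + l')%C by ring.
  rewrite E'. ring. }
destruct (H (Cmod (l - l')%C / 2) ltac:(lra)) as [T1 H1].
destruct (H' (Cmod (l - l')%C / 2) ltac:(lra)) as [T2 H2].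
set (T := Rmax T1 T2 + 1).
specialize (H1 T). specialize (H2 T).
pose proof (Rmax_l T1 T2). pose proof (Rmax_r T1 T2).
specialize (H1 ltac:(unfold T; lra)). specialize (H2 ltac:(unfold T; lra)).
pose proof (Cmod_triangle (CRInt f (- T) T - l') (- (CRInt f (- T) T - l)))%C as Tr.
rewrite Cmod_opp in Tr.
replace (CRInt f (- T) T - l' + - (CRInt f (- T) T - l))%C with (l - l')%C in Tr by ring.
lra.
Qed.

Lemma sym_lim_Cmult (c : C) (f : R -> C) (l : C) :
  (forall t, path_continuous f t) -> sym_lim f l ->
  sym_lim (fun t => c * f t)%C (c * l)%C.
Proof.
intros Hc H eps Heps. pose proof (Cmod_ge_0 c) as Pc.
destruct (H (eps / (Cmod c + 1))) as [T0 HT]; [apply Rdiv_lt_0_compat; lra|].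
exists T0; intros T HT'. specialize (HT T HT').
rewrite (CRInt_unique _ _ _ _ (is_CRInt_Cmult c f (- T) T _
  (CRInt_correct f _ _ (ex_CRInt_continuous f _ _ Hc)))).
replace (c * CRInt f (- T) T - c * l)%C with (c * (CRInt f (- T) T - l))%C by ring.
rewrite Cmod_mult.
apply Rle_lt_trans with (Cmod c * (eps / (Cmod c + 1))).
- apply Rmult_le_compat_l; lra.
- apply Rmult_lt_reg_r with (Cmod c + 1); [lra|].
  replace (Cmod c * (eps / (Cmod c + 1)) * (Cmod c + 1)) with (Cmod c * eps)
    by (field; lra). nra.
Qed.

Lemma sym_lim_plus (f g : R -> C) (l m : C) :
  (forall t, path_continuous f t) -> (forall t, path_continuous g t) ->
  sym_lim f l -> sym_lim g m -> sym_lim (fun t => f t + g t)%C (l + m)%C.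
Proof.
intros Cf Cg Hf Hg eps Heps.
destruct (Hf (eps / 2) ltac:(lra)) as [T1 H1].
destruct (Hg (eps / 2) ltac:(lra)) as [T2 H2].
exists (Rmax T1 T2); intros T HT.
pose proof (Rmax_l T1 T2). pose proof (Rmax_r T1 T2).
specialize (H1 T ltac:(lra)). specialize (H2 T ltac:(lra)).
rewrite (CRInt_unique (fun t => f t + g t)%C (- T) T
  (CRInt f (- T) T + CRInt g (- T) T)%C).
- replace (CRInt f (- T) T + CRInt g (- T) T - (l + m))%C
    with ((CRInt f (- T) T - l) + (CRInt g (- T) T - m))%C by ring.
  eapply Rle_lt_trans; [apply Cmod_triangle|lra].
- apply (is_RInt_plus (V := C_R_NormedModule)); apply CRInt_correct;
  now apply ex_CRInt_continuous.
Qed.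

(** Each half-line contributes at most [2 * K], the integral of [K * exp (- t / 2)]. *)
Lemma sym_lim_Cmod_le (K : R) (f : R -> C) (l : C) :
  exp_bounded K f -> sym_lim f l -> Cmod l <= 4 * K.
Proof.
intros HK H. apply le_epsilon; intros eps Heps.
destruct (H eps Heps) as [T0 HT].
set (T := Rmax T0 0 + 1). pose proof (Rmax_l T0 0). pose proof (Rmax_r T0 0).
specialize (HT T ltac:(unfold T; lra)).
assert (Hex : forall a b, ex_CRInt f a b)
  by (intros; apply ex_CRInt_continuous, HK).
assert (B : Cmod (CRInt f (- T) T) <= 4 * K).
{ rewrite <- (CRInt_Chasles f (- T) 0 T) by apply Hex.
  eapply Rle_trans; [apply Cmod_triangle|].
  pose proof (CRInt_tail_pos K f 0 T HK ltac:(unfold T; lra)) as B1.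
  pose proof (CRInt_tail_neg K f 0 T HK ltac:(unfold T; lra)) as B2.
  rewrite Ropp_0 in B2. replace (- (0 / 2)) with 0 in B1, B2 by field.
  rewrite exp_0 in *. lra. }
pose proof (Cmod_triangle (CRInt f (- T) T) (- (CRInt f (- T) T - l))%C) as Tr.
rewrite Cmod_opp in Tr.
replace (CRInt f (- T) T + - (CRInt f (- T) T - l))%C with l in Tr by ring.
lra.
Qed.

(** * Moving a vertical line of integration *)

Lemma is_derive_eps (g : R -> R) (t d : R) :
  (forall eps, 0 < eps -> exists del, 0 < del /\
    forall h, Rabs h < del -> Rabs (g (t + h) - g t - d * h) <= eps * Rabs h) ->
  is_derive g t d.
Proof.
intros H; split; [apply is_linear_scal_l|].
intros x Hx eps.
assert (x = t) as -> by (symmetry; apply is_filter_lim_locally_unique, Hx).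
destruct (H eps (cond_pos eps)) as [del [Hd Hdel]].
exists (mkposreal del Hd); intros y Hy.
specialize (Hdel (y - t) Hy).
assert (E : forall a b : R, a + (b - a) = b) by (intros; ring).
rewrite E, (Rmult_comm d) in Hdel. exact Hdel.
Qed.

Lemma is_Cderiv_Cmult (c : C) (f : C -> C) (z d : C) :
  is_Cderiv f z d -> is_Cderiv (fun w => c * f w)%C z (c * d)%C.
Proof.
intros H. replace (c * d)%C with (RtoC 0 * f z + c * d)%C by ring.
apply (is_derive_mult (K := C_AbsRing) (fun _ => c) f z (RtoC 0) d);
[apply (is_derive_const (K := C_AbsRing) (V := AbsRing_NormedModule C_AbsRing))
|exact H|exact Cmult_comm].
Qed.

(** The directions [e = 1] and [e = Ci] give the two partial derivatives, and so the Cauchy-Riemann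
    equations. *)
Lemma is_derive_Re_path (f : C -> C) (p : R -> C) (t : R) (e d : C) :
  Cmod e = 1 -> (forall h : R, p (t + h) = (p t + h * e)%C) ->
  is_Cderiv f (p t) d -> is_derive (fun r => Re (f (p r))) t (Re (d * e)%C).
Proof.
intros He Hp Hd. apply is_derive_eps; intros eps Heps.
destruct (proj1 (is_Cderiv_eps f (p t) d) Hd eps Heps) as [del [Hdel H]].
exists del; split; [exact Hdel|]. intros h Hh.
assert (Hm : Cmod (h * e)%C = Rabs h) by (rewrite Cmod_mult, He, Cmod_R; ring).
specialize (H (h * e)%C). rewrite Hm in H. specialize (H Hh).
rewrite Hp.
eapply Rle_trans; [|exact H].
eapply Rle_trans; [|apply re_le_Cmod]. right; f_equal.
generalize (f (p t + h * e)%C) (f (p t)); intros [] [].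
destruct d, e; simpl; ring.
Qed.

Lemma Ccontinuous_Re_2d (f : C -> C) (x y : R) :
  Ccontinuous f (x, y) -> continuity_2d_pt (fun u v => Re (f (u, v))) x y.
Proof.
intros H. apply continuity_2d_pt_filterlim.
apply Ccontinuous_pair in H.
apply (filterlim_ext (fun z : C => Re (f z))); [now intros []|].
apply (filterlim_comp _ _ _ f Re _ (locally (f (x, y))) _ H).
destruct (f (x, y)). apply (continuous_fst (U := R_UniformSpace)).
Qed.

Definition is_open (U : C -> Prop) : Prop :=
  forall z, U z -> exists r, 0 < r /\ forall w, Cmod w < r -> U (z + w)%C.

Lemma is_open_2d U x y : is_open U -> U (x, y) ->
  exists r, 0 < r /\ forall u v, Rabs (u - x) < r -> Rabs (v - y) < r -> U (u, v).
Proof.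
intros HU Hz. destruct (HU _ Hz) as [r [Hr H]].
exists (r / 2); split; [lra|]. intros a b Ha Hb.
replace (a, b) with ((x, y) + (a - x, b - y)%R)%C
  by (unfold Cplus; simpl; f_equal; ring).
apply H. eapply Rle_lt_trans; [apply Cmod_le_Rabs|lra].
Qed.

Lemma path_continuous_vline (f : C -> C) (x y : R) :
  Ccontinuous f (x, y) -> path_continuous (fun t => f (x, t)) y.
Proof.
intros H. apply Ccontinuous_pair in H.
apply (continuous_comp (V := C_UniformSpace) (fun t : R => ((x, t) : C)) f); [|exact H].
apply (continuous_comp_2 (U := R_UniformSpace) (V := R_UniformSpace)
  (W := R_UniformSpace) (X := C_UniformSpace) (fun _ => x) (fun t => t)
  (fun a b => (a, b))).
- apply continuous_const.
- apply continuous_id.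
- apply continuous_ext with (f := fun x => x); [now intros []|apply continuous_id].
Qed.

Lemma Re_path_continuous (f : R -> C) (y : R) : path_continuous f y ->
  continuous (T := R_UniformSpace) (U := R_UniformSpace) (fun t => Re (f t)) y.
Proof.
intros H. apply (continuous_comp (V := C_UniformSpace) f Re y H).
destruct (f y). apply (continuous_fst (U := R_UniformSpace)).
Qed.

(** Under the integral the x-derivative of [Re f] is [Re f'], which is also the y-derivative of
    [Im f]. It integrates to [Im f (x, d) - Im f (x, c)], at most [2 * M], and the mean value
    theorem in [x] concludes. *)
Lemma Rabs_sub_RInt_Re_le (U : C -> Prop) (f : C -> C) (a b c d M x1 x2 : R) :
  is_open U -> holo U f -> c <= d -> a < x1 -> x1 <= x2 -> x2 < b ->
  (forall x y, a < x < b -> c <= y <= d -> U (x, y)) ->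
  (forall x, a < x < b -> Cmod (f (x, c)) <= M /\ Cmod (f (x, d)) <= M) ->
  Rabs (RInt (fun t => Re (f (x2, t))) c d - RInt (fun t => Re (f (x1, t))) c d)
    <= 2 * M * (x2 - x1).
Proof.
intros HU [f' Hf] Hcd Ha H12 Hb Hin HM.
assert (Hx : forall x y, U (x, y) ->
  is_derive (fun r => Re (f (r, y))) x (Re (f' (x, y)))).
{ intros x y Hz. destruct (Hf _ Hz) as [D _].
  replace (Re (f' (x, y))) with (Re (f' (x, y) * 1)%C)
    by (destruct (f' (x, y)); simpl; ring).
  apply (is_derive_Re_path f (fun r => (r, y)) x 1); [apply Cmod_1| |exact D].
  intros h. unfold RtoC, Cplus, Cmult; simpl; f_equal; ring. }
assert (Hy : forall x y, U (x, y) ->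
  is_derive (fun r => Im (f (x, r))) y (Re (f' (x, y)))).
{ intros x y Hz. destruct (Hf _ Hz) as [D _].
  (* [Im f] is the real part of [- Ci * f], and the upward direction [Ci] cancels the factor
     [- Ci]. *)
  replace (Re (f' (x, y))) with (Re (- Ci * f' (x, y) * Ci)%C)
    by (destruct (f' (x, y)); simpl; ring).
  apply (is_derive_ext (fun r => Re (- Ci * f (x, r))%C)); 
    [intros r; destruct (f (x, r)); simpl; ring|].
  apply (is_derive_Re_path (fun z => - Ci * f z)%C (fun r => (x, r)) y Ci);
  [apply Cmod_Ci| |].
  - intros h. unfold RtoC, Ci, Cplus, Cmult; simpl; f_equal; ring.
  - now apply is_Cderiv_Cmult. }
assert (Hc : forall x, a < x < b -> forall y, c <= y <= d ->
  path_continuous (fun t => f (x, t)) y).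
{ intros x Hx' y Hy'. apply path_continuous_vline.
  exact (Cderiv_continuous _ _ _ (proj1 (Hf _ (Hin x y Hx' Hy')))). }
assert (Hint : forall x, a < x < b -> ex_RInt (fun t => Re (f (x, t))) c d).
{ intros x Hx'. apply (ex_RInt_continuous (V := R_CompleteNormedModule)).
  rewrite Rmin_left, Rmax_right by lra. intros y Hy'.
  apply Re_path_continuous. now apply Hc. }
assert (Hnear : forall x, a < x < b -> locally x (fun u => a < u < b)).
{ intros x Hx'. apply filter_and; [apply open_gt|apply open_lt]; lra. }
set (g := fun x => RInt (fun t => Re (f (x, t))) c d).
assert (Hg : forall x, a < x < b ->
  is_derive g x (Im (f (x, d)) - Im (f (x, c)))).
{ intros x Hx'.
  assert (E : RInt (fun t => Derive (fun r => Re (f (r, t))) x) c d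
     = Im (f (x, d)) - Im (f (x, c))).
  { rewrite (RInt_ext _ (fun t => Re (f' (x, t)))).
    2:{ rewrite Rmin_left, Rmax_right by lra. intros t Ht.
        apply is_derive_unique, Hx, Hin; lra. }
    apply is_RInt_unique.
    apply (is_RInt_derive (V := R_CompleteNormedModule) (fun t => Im (f (x, t))));
    rewrite Rmin_left, Rmax_right by lra; intros t Ht.
    - now apply Hy, Hin.
    - apply Re_path_continuous, path_continuous_vline, Hf. now apply Hin. }
  rewrite <- E. apply is_derive_RInt_param; rewrite ?Rmin_left, ?Rmax_right by lra.
  - generalize (Hnear x Hx'). apply filter_imp. intros u Hu t Ht.
    eexists. now apply Hx, Hin.
  - intros t Ht.
    apply continuity_2d_pt_ext_loc with (f := fun u v => Re (f' (u, v))).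
    + destruct (is_open_2d U x t HU (Hin x t Hx' Ht)) as [r [Hr H]].
      exists (mkposreal r Hr); intros u v Hu Hv. symmetry.
      apply is_derive_unique, Hx. now apply H.
    + apply Ccontinuous_Re_2d, Hf. now apply Hin.
  - generalize (Hnear x Hx'). apply filter_imp. exact Hint. }
destruct (MVT_gen g x1 x2 (fun x => Im (f (x, d)) - Im (f (x, c)))) as [x [Hx' E]];
rewrite ?Rmin_left, ?Rmax_right in * by lra.
- intros x Hx'. apply Hg; lra.
- intros x Hx'. apply continuity_pt_filterlim, (ex_derive_continuous g).
  eexists; apply Hg; lra.
- fold (g x1) (g x2). rewrite E, Rabs_mult, (Rabs_pos_eq (x2 - x1)) by lra.
  apply Rmult_le_compat_r; [lra|].
  destruct (HM x ltac:(lra)) as [M1 M2].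
  pose proof (im_le_Cmod (f (x, c))). pose proof (im_le_Cmod (f (x, d))).
  eapply Rle_trans; [apply Rabs_triang|]. rewrite Rabs_Ropp. lra.
Qed.

(* Green: the x-derivative of a vertical integral is a difference of values at
   the two ends, so only the horizontal sides matter. *)
Lemma Cmod_sub_CRInt_le (U : C -> Prop) (f : C -> C) (a b c d M x1 x2 : R) :
  is_open U -> holo U f -> c <= d -> a < x1 -> x1 <= x2 -> x2 < b ->
  (forall x y, a < x < b -> c <= y <= d -> U (x, y)) ->
  (forall x, a < x < b -> Cmod (f (x, c)) <= M /\ Cmod (f (x, d)) <= M) ->
  Cmod (CRInt (fun t => f (x2, t)) c d - CRInt (fun t => f (x1, t)) c d)%C
    <= 4 * M * (x2 - x1).
Proof.
intros HU Hf Hcd Ha H12 Hb Hin HM.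
assert (Hex : forall x, a < x < b -> ex_CRInt (fun t => f (x, t)) c d).
{ intros x Hx. apply (ex_RInt_continuous (V := C_R_CompleteNormedModule)).
  rewrite Rmin_left, Rmax_right by lra. intros t Ht.
  apply path_continuous_vline, (holo_continuous U); [exact Hf|]. now apply Hin. }
pose proof (proj1 (is_CRInt_pair _ _ _ _) (CRInt_correct _ _ _ (Hex x1 ltac:(lra))))
  as [R1 I1].
pose proof (proj1 (is_CRInt_pair _ _ _ _) (CRInt_correct _ _ _ (Hex x2 ltac:(lra))))
  as [R2 I2].
pose proof (Rabs_sub_RInt_Re_le U f a b c d M x1 x2 HU Hf Hcd Ha H12 Hb Hin HM) as B1.
(* Since [Re (- Ci * f) = Im f], the same estimate for [- Ci * f] covers the imaginary part. *)
pose proof (Rabs_sub_RInt_Re_le U (fun z => - Ci * f z)%C a b c d M x1 x2 HU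
  (holo_mult U _ f (holo_const U (- Ci)%C) Hf) Hcd Ha H12 Hb Hin) as B2.
rewrite (is_RInt_unique _ _ _ _ R1), (is_RInt_unique _ _ _ _ R2) in B1.
assert (Hrot : forall w : C, Re (- Ci * w)%C = Im w)
  by (intros []; simpl; ring).
cbv beta in B2.
rewrite (RInt_ext (fun t => Re (- Ci * f (x1, t))%C) (fun t => Im (f (x1, t)))) in B2
  by (intros t _; apply Hrot).
rewrite (RInt_ext (fun t => Re (- Ci * f (x2, t))%C) (fun t => Im (f (x2, t)))) in B2
  by (intros t _; apply Hrot).
rewrite (is_RInt_unique _ _ _ _ I1), (is_RInt_unique _ _ _ _ I2) in B2.
assert (B3 := B2 ltac:(intros x Hx; rewrite !Cmod_mult, Cmod_opp, Cmod_Ci, !Rmult_1_l;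
  now apply HM)); clear B2.
apply Rle_trans with (2 * M * (x2 - x1) + 2 * M * (x2 - x1)); [|lra].
eapply Rle_trans; [apply Cmod_le_Rabs|exact (Rplus_le_compat _ _ _ _ B1 B3)].
Qed.

(** A square of half side [del] around the puncture is cut out. Outside [p - del], [p + del] the
    whole segment moves; between them only the pieces above and below the square do. The sides of
    the square contribute a multiple of [M * del], which tends to zero. *)
Lemma Cmod_sub_CRInt_punctured (U : C -> Prop) (f : C -> C)
  (a b p r M T eta x1 x2 : R) :
  is_open U -> holo U f -> a < x1 < p -> p < x2 < b -> 0 < r -> 0 < T ->
  (forall x y, a < x < b -> x <> p \/ y <> 0 -> U (x, y)) ->
  (forall x y, Rabs (x - p) < r -> Rabs y < r -> x <> p \/ y <> 0 ->
    Cmod (f (x, y)) <= M) ->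
  (forall x, a < x < b -> Cmod (f (x, - T)) <= eta /\ Cmod (f (x, T)) <= eta) ->
  Cmod (CRInt (fun t => f (x2, t)) (- T) T - CRInt (fun t => f (x1, t)) (- T) T)%C
    <= 4 * eta * (x2 - x1).
Proof.
intros HU Hf H1 H2 Hr HT Hin HM Heta.
apply le_epsilon; intros eps Heps.
set (M' := Rmax (Rmax M eta) 0).
assert (HM1 : M <= M') by (eapply Rle_trans; [apply Rmax_l|apply Rmax_l]).
assert (HM2 : eta <= M') by (eapply Rle_trans; [apply Rmax_r|apply Rmax_l]).
assert (HM3 : 0 <= M') by apply Rmax_r.
(* The total 20 is twice [4 * M' * (2 * del)] for the pieces above and below, plus twice
   [2 * del * M'] for the vertical sides. The factor 2 before [del] leaves an open strip around the
   square. *)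
assert (Hdel : exists del, 0 < del /\ 2 * del < r /\ 2 * del < p - x1 /\ 2 * del < x2 - p
  /\ del < T /\ 20 * M' * del <= eps).
{ set (d0 := Rmin (Rmin (r / 4) (T / 2)) (Rmin ((p - x1) / 4) ((x2 - p) / 4))).
  assert (P0 : 0 < d0) by (repeat apply Rmin_glb_lt; lra).
  assert (P1 : 0 < eps / (20 * M' + 1)) by (apply Rdiv_lt_0_compat; lra).
  exists (Rmin d0 (eps / (20 * M' + 1))).
  pose proof (Rmin_l d0 (eps / (20 * M' + 1))).
  pose proof (Rmin_r d0 (eps / (20 * M' + 1))).
  assert (d0 <= r / 4) by (eapply Rle_trans; apply Rmin_l).
  assert (d0 <= T / 2) by (eapply Rle_trans; [apply Rmin_l|apply Rmin_r]).
  assert (d0 <= (p - x1) / 4) by (eapply Rle_trans; [apply Rmin_r|apply Rmin_l]).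
  assert (d0 <= (x2 - p) / 4) by (eapply Rle_trans; apply Rmin_r).
  assert (0 < Rmin d0 (eps / (20 * M' + 1))) by now apply Rmin_glb_lt.
  repeat split; try lra.
  apply Rle_trans with (20 * M' * (eps / (20 * M' + 1)));
  [apply Rmult_le_compat_l; lra|].
  apply Rmult_le_reg_r with (20 * M' + 1); [lra|].
  replace (20 * M' * (eps / (20 * M' + 1)) * (20 * M' + 1)) with (20 * M' * eps)
    by (field; lra). nra. }
destruct Hdel as [d [D0 [D1 [D2 [D3 [D4 D5]]]]]].
set (J := fun x c e => CRInt (fun t => f (x, t)) c e : C).
assert (Hex : forall x c e, a < x < b -> x <> p -> ex_CRInt (fun t => f (x, t)) c e).
{ intros x c e Hx Hxp. apply (ex_RInt_continuous (V := C_R_CompleteNormedModule)).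
  intros t _. apply path_continuous_vline, (holo_continuous U); [exact Hf|].
  apply Hin; tauto. }
assert (L : Cmod (J (p - d) (- T) T - J x1 (- T) T) <= 4 * eta * (p - d - x1)).
{ apply (Cmod_sub_CRInt_le U f a p); auto; try lra.
  - intros x y Hx _. apply Hin; [lra|left; lra].
  - intros x Hx. apply Heta; lra. }
assert (Rr : Cmod (J x2 (- T) T - J (p + d) (- T) T) <= 4 * eta * (x2 - (p + d))).
{ apply (Cmod_sub_CRInt_le U f p b); auto; try lra.
  - intros x y Hx _. apply Hin; [lra|left; lra].
  - intros x Hx. apply Heta; lra. }
assert (Hside : forall x y, p - 2 * d < x < p + 2 * d -> Rabs y = d ->
  Cmod (f (x, y)) <= M').
{ intros x y Hx Hy. eapply Rle_trans; [apply HM|exact HM1].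
  - apply Rabs_lt_between; lra.
  - lra.
  - right. intros ->. rewrite Rabs_R0 in Hy. lra. }
assert (B1 : Cmod (J (p + d) (- T) (- d) - J (p - d) (- T) (- d))
  <= 4 * M' * (p + d - (p - d))).
{ apply (Cmod_sub_CRInt_le U f (p - 2 * d) (p + 2 * d)); auto; try lra.
  - intros x y Hx Hy. apply Hin; [lra|right; lra].
  - intros x Hx. split.
    + destruct (Heta x ltac:(lra)); lra.
    + apply Hside; [lra|]. rewrite Rabs_left1; lra. }
assert (B2 : Cmod (J (p + d) d T - J (p - d) d T) <= 4 * M' * (p + d - (p - d))).
{ apply (Cmod_sub_CRInt_le U f (p - 2 * d) (p + 2 * d)); auto; try lra.
  - intros x y Hx Hy. apply Hin; [lra|right; lra].
  - intros x Hx. split.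
    + apply Hside; [lra|]. rewrite Rabs_pos_eq; lra.
    + destruct (Heta x ltac:(lra)); lra. }
assert (B3 : forall x, a < x < b -> Rabs (x - p) = d -> Cmod (J x (- d) d) <= (d - - d) * M').
{ intros x Hx Hxd. apply Cmod_CRInt_le_const; [lra| |].
  - intros t Ht. eapply Rle_trans; [apply HM|exact HM1]; [lra| |].
    + apply Rabs_lt_between; lra.
    + left. intros ->. rewrite Rminus_diag, Rabs_R0 in Hxd. lra.
  - apply Hex; [exact Hx|]. intros ->. rewrite Rminus_diag, Rabs_R0 in Hxd. lra. }
pose proof (B3 (p + d) ltac:(lra) ltac:(rewrite Rabs_pos_eq; lra)) as B4.
pose proof (B3 (p - d) ltac:(lra) ltac:(rewrite Rabs_left1; lra)) as B5.
assert (Hsplit : forall x, a < x < b -> x <> p ->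
  J x (- T) T = Cplus (Cplus (J x (- T) (- d)) (J x (- d) d)) (J x d T)).
{ intros x Hx Hxp. unfold J.
  rewrite (CRInt_Chasles (fun t => f (x, t)) (- T) (- d) d) by now apply Hex.
  rewrite (CRInt_Chasles (fun t => f (x, t)) (- T) d T) by now apply Hex.
  reflexivity. }
fold (J x2 (- T) T) (J x1 (- T) T).
rewrite (Hsplit (p + d)) in Rr by lra. rewrite (Hsplit (p - d)) in L by lra.
revert L Rr B1 B2 B4 B5.
generalize (J x2 (- T) T), (J x1 (- T) T), (J (p + d) (- T) (- d)), (J (p + d) (- d) d),
  (J (p + d) d T), (J (p - d) (- T) (- d)), (J (p - d) (- d) d), (J (p - d) d T).
intros j2 j1 r1 r2 r3 s1 s2 s3 L Rr B1 B2 B4 B5.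
replace (j2 - j1)%C with ((j2 - (r1 + r2 + r3)) + ((s1 + s2 + s3) - j1)
  + (r1 - s1) + (r3 - s3) + r2 + - s2)%C by ring.
(* Each round peels off the last summand and subtracts its modulus from the right-hand side. *)
do 5 (eapply Rle_trans; [apply Cmod_triangle|];
  match goal with |- _ + ?v <= ?w => apply Rle_trans with (w - v + v); [|lra];
    apply Rplus_le_compat_r end).
rewrite Cmod_opp.
assert (0 <= eta * d).
{ apply Rmult_le_pos; [|lra]. eapply Rle_trans; [apply Cmod_ge_0|].
  apply (proj1 (Heta x1 ltac:(lra))). }
lra.
Qed.

(* A bounded isolated singularity is invisible to the line integral. *)
Lemma vline_shift (U : C -> Prop) (f : C -> C) (a b p x1 x2 : R) (l1 l2 : C) :
  is_open U -> holo U f -> a < x1 < p -> p < x2 < b ->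
  (forall x y, a < x < b -> x <> p \/ y <> 0 -> U (x, y)) ->
  (exists r M, 0 < r /\ forall x y, Rabs (x - p) < r -> Rabs y < r ->
    x <> p \/ y <> 0 -> Cmod (f (x, y)) <= M) ->
  (forall eps, 0 < eps -> exists T, forall x y, a < x < b -> T < Rabs y ->
    Cmod (f (x, y)) <= eps) ->
  sym_lim (fun t => f (x1, t)) l1 -> sym_lim (fun t => f (x2, t)) l2 -> l1 = l2.
Proof.
intros HU Hf H1 H2 Hin [r [M [Hr HM]]] Hdec S1 S2.
enough (H : Cmod (l2 - l1)%C <= 0).
{ pose proof (Cmod_ge_0 (l2 - l1)%C).
  assert (E : (l2 - l1)%C = 0%C) by (apply Cmod_eq_0; lra).
  replace l2 with ((l2 - l1) + l1)%C by ring. rewrite E; ring. }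
apply le_epsilon; intros eps Heps. rewrite Rplus_0_l.
destruct (S1 (eps / 4) ltac:(lra)) as [T1 HT1].
destruct (S2 (eps / 4) ltac:(lra)) as [T2 HT2].
(* With this choice the horizontal sides cost [4 * eta * (x2 - x1) = eps / 2], and the two symmetric
   limits a quarter of [eps] each. *)
set (eta := eps / (8 * (x2 - x1))).
assert (Heta : 0 < eta) by (apply Rdiv_lt_0_compat; lra).
destruct (Hdec eta Heta) as [T3 HT3].
set (T := Rmax (Rmax T1 T2) (Rmax T3 0) + 1).
assert (G1 : T1 <= Rmax (Rmax T1 T2) (Rmax T3 0))
  by (eapply Rle_trans; [apply Rmax_l|apply Rmax_l]).
assert (G2 : T2 <= Rmax (Rmax T1 T2) (Rmax T3 0))
  by (eapply Rle_trans; [apply Rmax_r|apply Rmax_l]).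
assert (G3 : T3 <= Rmax (Rmax T1 T2) (Rmax T3 0))
  by (eapply Rle_trans; [apply Rmax_l|apply Rmax_r]).
assert (G4 : 0 <= Rmax (Rmax T1 T2) (Rmax T3 0))
  by (eapply Rle_trans; [apply Rmax_r|apply Rmax_r]).
specialize (HT1 T ltac:(unfold T; lra)). specialize (HT2 T ltac:(unfold T; lra)).
pose proof (Cmod_sub_CRInt_punctured U f a b p r M T eta x1 x2 HU Hf H1 H2 Hr
  ltac:(unfold T; lra) Hin HM) as B.
assert (B' := B ltac:(intros x Hx; split; apply HT3; [exact Hx| |exact Hx|];
  rewrite ?Rabs_Ropp, Rabs_pos_eq by (unfold T; lra); unfold T; lra)); clear B.
replace (4 * eta * (x2 - x1)) with (eps / 2) in B' by (unfold eta; field; lra).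
revert HT1 HT2 B'.
generalize (CRInt (fun t => f (x1, t)) (- T) T) (CRInt (fun t => f (x2, t)) (- T) T).
simpl; intros j1 j2 HT1 HT2 B'.
replace (l2 - l1)%C with (- (j2 - l2) + ((j2 - j1) + (j1 - l1)))%C by ring.
eapply Rle_trans; [apply Cmod_triangle|]. rewrite Cmod_opp.
pose proof (Cmod_triangle (j2 - j1) (j1 - l1)). lra.
Qed.

(** * The kernel [F] *)

Lemma Ccos_pair (x y : R) :
  Ccos (x, y) = (cos x * cosh y, - (sin x * sinh y)).
Proof.
unfold Ccos, Cexp, cosh, sinh; simpl.
replace (0 * x - 1 * y) with (- y) by ring.
replace (0 * y + 1 * x) with x by ring.
rewrite Ropp_involutive, cos_neg, sin_neg.
unfold Cdiv, Cinv, Cmult, Cplus, RtoC; simpl; f_equal; field.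
Qed.

Definition F_denom (z : C) : C := (1 + 2 * Ccos (2 * z))%C.

Lemma F_denom_pair (x y : R) :
  F_denom (x, y) = (1 + 2 * (cos (2 * x) * cosh (2 * y)),
                    - (2 * (sin (2 * x) * sinh (2 * y)))).
Proof.
unfold F_denom.
replace (2 * (x, y))%C with ((2 * x)%R, (2 * y)%R)
  by (unfold Cmult, RtoC; simpl; f_equal; ring).
rewrite Ccos_pair. unfold Cplus, Cmult, RtoC; simpl; f_equal; ring.
Qed.

Lemma cosh2_sinh2 (y : R) : cosh y * cosh y - sinh y * sinh y = 1.
Proof.
unfold cosh, sinh.
replace 1 with (exp y * exp (- y)) by (rewrite <- exp_plus, Rplus_opp_r; apply exp_0).
field.
Qed.

Lemma cosh_ge_1 (y : R) : 1 <= cosh y.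
Proof.
pose proof (cosh2_sinh2 y).
assert (0 < cosh y) by (unfold cosh; pose proof (exp_pos y); pose proof (exp_pos (-y)); lra).
nra.
Qed.

Lemma cosh_le_exp (y : R) : cosh y <= exp (Rabs y).
Proof.
unfold cosh.
assert (exp y <= exp (Rabs y)).
{ destruct (Rle_abs y) as [H|H]; [left; now apply exp_increasing|rewrite <- H; lra]. }
assert (exp (- y) <= exp (Rabs y)).
{ rewrite <- Rabs_Ropp.
  destruct (Rle_abs (- y)) as [H'|H']; [left; now apply exp_increasing|rewrite <- H'; lra]. }
lra.
Qed.

Lemma cosh_ge_exp (y : R) : exp (Rabs y) / 2 <= cosh y.
Proof.
unfold cosh. pose proof (exp_pos y). pose proof (exp_pos (- y)).
unfold Rabs; destruct (Rcase_abs y); lra.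
Qed.

Lemma Cmod_Ccos_le (x y : R) : Cmod (Ccos (x, y)) <= cosh y.
Proof.
pose proof (cosh_ge_1 y). pose proof (cosh2_sinh2 y).
rewrite <- (sqrt_Rsqr (cosh y)) by lra.
rewrite Ccos_pair. unfold Cmod; apply sqrt_le_1_alt; simpl.
pose proof (sin2_cos2 x). unfold Rsqr in *.
assert (sin x * sin x * (sinh y * sinh y) <= sin x * sin x * (cosh y * cosh y))
  by (apply Rmult_le_compat_l; nra).
nra.
Qed.

Lemma Cmod_F_denom_sqr (x y : R) :
  Cmod (F_denom (x, y)) ^ 2 =
  (2 * cosh (2 * y) + cos (2 * x)) ^ 2 + 3 * cos (2 * x) ^ 2 - 3.
Proof.
rewrite F_denom_pair, Cmod2_alt; simpl.
pose proof (sin2_cos2 (2 * x)). pose proof (cosh2_sinh2 (2 * y)). unfold Rsqr in *.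
generalize dependent (sin (2 * x)); generalize dependent (sinh (2 * y)).
generalize (cos (2 * x)) (cosh (2 * y)); intros c H sh Hs s Hc.
assert (s * s * (sh * sh) = (1 - c * c) * (H * H - 1)) by (f_equal; lra).
nra.
Qed.

(** Valid at every height, with a constant that degenerates exactly on the lines through poles. It
    serves fixed vertical lines; [Cmod_F_denom_ge_far], uniform in [x], serves horizontal sides
    across a whole strip. *)
Lemma Cmod_F_denom_ge (x y : R) :
  Rabs (1 + 2 * cos (2 * x)) * cosh (2 * y) / 3 <= Cmod (F_denom (x, y)).
Proof.
pose proof (Cmod_F_denom_sqr x y) as E. pose proof (cosh_ge_1 (2 * y)) as H1.
pose proof (COS_bound (2 * x)) as [C1 C2].
apply Rsqr_incr_0_var; [|apply Cmod_ge_0].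
unfold Rsqr. replace (Cmod _ * Cmod _) with (Cmod (F_denom (x, y)) ^ 2) by ring.
rewrite E.
replace (Rabs (1 + 2 * cos (2 * x)) * cosh (2 * y) / 3 *
  (Rabs (1 + 2 * cos (2 * x)) * cosh (2 * y) / 3)) with
  (Rabs (1 + 2 * cos (2 * x)) ^ 2 * (cosh (2 * y) * cosh (2 * y)) / 9) by field.
rewrite pow2_abs.
generalize dependent (cos (2 * x)); generalize dependent (cosh (2 * y)).
intros H H1 c E C1 C2.
assert (Q : 0 <= 4 - (1 + 2 * c) ^ 2 / 9 - 3) by nra.
set (q := (1 + 2 * c) ^ 2 / 9) in *.
assert (9 * q = (1 + 2 * c) ^ 2) by (unfold q; field).
(* As a function of [H], the difference of the two squares equals [8 * q] at [H = 1]; this product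
   is its increment from there. *)
assert (0 <= (H - 1) * ((4 - q) * (H + 1) + 4 * c)).
{ apply Rmult_le_pos; [lra|]. nra. }
replace ((1 + 2 * c) ^ 2 * (H * H) / 9) with (q * (H * H)) by (unfold q; field).
nra.
Qed.

Lemma Cmod_F_denom_ge_far (x y : R) : 1 <= Rabs y ->
  cosh (2 * y) <= Cmod (F_denom (x, y)).
Proof.
intros Hy.
pose proof (Cmod_F_denom_sqr x y) as E. pose proof (COS_bound (2 * x)) as [C1 C2].
assert (H2 : 2 <= cosh (2 * y)).
{ eapply Rle_trans; [|apply cosh_ge_exp].
  rewrite Rabs_mult, (Rabs_pos_eq 2) by lra.
  pose proof (exp_ineq1_le (Rabs y)) as T.
  replace (2 * Rabs y) with (Rabs y + Rabs y) by ring. rewrite exp_plus. nra. }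
apply Rsqr_incr_0_var; [|apply Cmod_ge_0].
unfold Rsqr. replace (Cmod _ * Cmod _) with (Cmod (F_denom (x, y)) ^ 2) by ring.
rewrite E. nra.
Qed.

Lemma F_denom_neq_0 (x y : R) : y <> 0 \/ 1 + 2 * cos (2 * x) <> 0 ->
  F_denom (x, y) <> 0%C.
Proof.
intros H. destruct (Req_dec (1 + 2 * cos (2 * x)) 0) as [Hx|Hx].
- destruct H as [Hy|H]; [|contradiction].
  intros E. rewrite F_denom_pair in E. apply (f_equal fst) in E; simpl in E.
  assert (Hs : sinh (2 * y) <> 0).
  { unfold sinh. intros H0.
    assert (exp (2 * y) = exp (- (2 * y))) by lra.
    apply exp_inv in H. lra. }
  pose proof (cosh2_sinh2 (2 * y)). pose proof (cosh_ge_1 (2 * y)). 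
  assert (cosh (2 * y) = 1) by nra. rewrite H1 in H. 
  assert (sinh (2 * y) * sinh (2 * y) = 0) by lra. nra.
- apply Cmod_gt_0. eapply Rlt_le_trans; [|apply Cmod_F_denom_ge].
  pose proof (cosh_ge_1 (2 * y)). pose proof (Rabs_pos_lt _ Hx). nra.
Qed.

Lemma Cmod_F (z : C) : F_denom z <> 0%C ->
  Cmod (F z) = 4 * sqrt 3 * Cmod (Ccos z) / Cmod (F_denom z).
Proof.
intros H. unfold F. fold (F_denom z).
rewrite Cmod_opp, Cmod_div, !Cmod_mult, !Cmod_R by exact H.
rewrite !Rabs_pos_eq; [reflexivity|apply sqrt_pos|lra].
Qed.

Lemma Cmod_F_le_of_denom (k : R) (x y : R) : 0 < k ->
  k * cosh (2 * y) <= Cmod (F_denom (x, y)) ->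
  Cmod (F (x, y)) <= 8 * sqrt 3 / k * exp (- Rabs y).
Proof.
intros Hk H. pose proof (cosh_ge_1 (2 * y)) as H1.
assert (HD : 0 < Cmod (F_denom (x, y))) by nra.
rewrite Cmod_F by now apply Cmod_gt_0.
pose proof (cosh_ge_exp (2 * y)) as H2.
rewrite Rabs_mult, (Rabs_pos_eq 2) in H2 by lra.
replace (2 * Rabs y) with (Rabs y + Rabs y) in H2 by ring. rewrite exp_plus in H2.
pose proof (cosh_le_exp y) as H3. pose proof (Cmod_Ccos_le x y) as H4.
pose proof (Cmod_ge_0 (Ccos (x, y))). pose proof (sqrt_lt_R0 3 ltac:(lra)) as H5.
pose proof (exp_pos (Rabs y)) as H6.
apply Rmult_le_reg_r with (Cmod (F_denom (x, y))); [exact HD|].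
unfold Rdiv at 1. rewrite Rmult_assoc, Rinv_l, Rmult_1_r by lra.
apply Rle_trans with (8 * sqrt 3 / k * exp (- Rabs y) * (k * cosh (2 * y))).
2:{ apply Rmult_le_compat_l; [|exact H]. apply Rmult_le_pos; [|left; apply exp_pos].
    apply Rdiv_le_0_compat; lra. }
rewrite exp_Ropp.
replace (8 * sqrt 3 / k * / exp (Rabs y) * (k * cosh (2 * y)))
  with (4 * sqrt 3 * (2 * cosh (2 * y) * / exp (Rabs y))) by (field; lra).
apply Rmult_le_compat_l; [lra|].
apply Rle_trans with (exp (Rabs y)); [lra|].
apply Rmult_le_reg_r with (exp (Rabs y)); [exact H6|].
rewrite Rmult_assoc, Rinv_l by lra. lra.
Qed.

Lemma Cmod_F_le (x : R) : 1 + 2 * cos (2 * x) <> 0 ->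
  exists K, 0 <= K /\ forall y, Cmod (F (x, y)) <= K * exp (- Rabs y).
Proof.
intros Hx. pose proof (Rabs_pos_lt _ Hx) as H.
exists (8 * sqrt 3 / (Rabs (1 + 2 * cos (2 * x)) / 3)); split.
- apply Rdiv_le_0_compat; [|lra]. pose proof (sqrt_pos 3); lra.
- intros y. apply Cmod_F_le_of_denom; [lra|].
  eapply Rle_trans; [|apply Cmod_F_denom_ge]. right; field.
Qed.

Lemma Cmod_F_le_far (x y : R) : 1 <= Rabs y ->
  Cmod (F (x, y)) <= 8 * sqrt 3 * exp (- Rabs y).
Proof.
intros Hy. replace (8 * sqrt 3) with (8 * sqrt 3 / 1) by field.
apply Cmod_F_le_of_denom; [lra|]. rewrite Rmult_1_l. now apply Cmod_F_denom_ge_far.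
Qed.

Lemma holo_Ccos U : holo U Ccos.
Proof.
unfold Ccos, Cdiv. apply holo_mult; [|apply holo_const].
assert (H : holo U (fun z => Ci * z)%C) by (apply holo_mult; [apply holo_const|apply holo_id]).
assert (H' : forall f, holo U f -> holo U (fun z => Cexp (f z)))
  by (intros f Hf; apply (holo_comp U (fun _ => True) f Cexp); auto using holo_Cexp).
apply holo_plus; [now apply H'|].
destruct (H' (fun z => - (1) * (Ci * z))%C) as [g Hg].
{ now apply holo_mult; [apply holo_const|]. }
exists g; intros z Hz; destruct (Hg z Hz) as [D C]; split; [|exact C].
revert D; apply is_derive_ext; intros t. f_equal.
change (- (1) * (Ci * t) = - (Ci * t))%C. ring.
Qed.

Lemma holo_F_denom U : holo U F_denom.
Proof.
unfold F_denom. apply holo_plus; [apply holo_const|].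
apply holo_mult; [apply holo_const|].
apply (holo_comp U (fun _ => True) (fun z => 2 * z)%C Ccos); [auto| |apply holo_Ccos].
apply holo_mult; [apply holo_const|apply holo_id].
Qed.

Lemma holo_F : holo (fun z => F_denom z <> 0%C) F.
Proof.
assert (H : holo (fun z => F_denom z <> 0%C)
  (fun z => - (1) * (4 * sqrt 3 * Ccos z * / F_denom z))%C).
{ apply holo_mult; [apply holo_const|].
  apply holo_mult; [apply holo_mult; [apply holo_const|apply holo_Ccos]|].
  apply holo_inv; [auto|apply holo_F_denom]. }
destruct H as [g Hg].
exists g; intros z Hz; destruct (Hg z Hz) as [D C]; split; [|exact C].
revert D; apply is_derive_ext; intros t.
unfold F, Cdiv; fold (F_denom t).
change (- (1) * (4 * sqrt 3 * Ccos t * / F_denom t)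
  = - (4 * sqrt 3 * Ccos t * / F_denom t))%C. ring.
Qed.

Lemma is_Cderiv_Cexp_lin (a z : C) :
  is_Cderiv (fun w => Cexp (a * w)) z (a * Cexp (a * z))%C.
Proof.
apply (is_derive_comp (K := C_AbsRing) (V := AbsRing_NormedModule C_AbsRing)
  Cexp (fun w => a * w)%C z).
- apply is_Cderiv_Cexp.
- pose proof (is_Cderiv_Cmult a (fun w => w) z (RtoC 1)
    (is_derive_id (K := C_AbsRing) z)) as H.
  now rewrite Cmult_1_r in H.
Qed.

Lemma is_Cderiv_F_denom (p : R) :
  is_Cderiv F_denom (RtoC p) (RtoC (- 4 * sin (2 * p))).
Proof.
apply (is_derive_ext (K := C_AbsRing) (V := AbsRing_NormedModule C_AbsRing)
  (fun z => 1 + (Cexp (2 * Ci * z) + Cexp (- (2 * Ci) * z)))%C).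
{ intros t.
  change (1 + (Cexp (2 * Ci * t) + Cexp (- (2 * Ci) * t)) = F_denom t)%C.
  unfold F_denom, Ccos.
  replace (Ci * (2 * t))%C with (2 * Ci * t)%C by ring.
  replace (- (2 * Ci * t))%C with (- (2 * Ci) * t)%C by ring. field. }
replace (RtoC (- 4 * sin (2 * p))) with
  (0 + (2 * Ci * Cexp (2 * Ci * p) + - (2 * Ci) * Cexp (- (2 * Ci) * p)))%C.
- apply (is_derive_plus (K := C_AbsRing) (V := AbsRing_NormedModule C_AbsRing)
    (fun _ => RtoC 1) (fun z => Cexp (2 * Ci * z) + Cexp (- (2 * Ci) * z))%C).
  + apply (is_derive_const (K := C_AbsRing) (V := AbsRing_NormedModule C_AbsRing)).
  + apply (is_derive_plus (K := C_AbsRing) (V := AbsRing_NormedModule C_AbsRing));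
    apply is_Cderiv_Cexp_lin.
- replace (2 * Ci * p)%C with (0, 2 * p)%R
    by (unfold Cmult, Ci, RtoC; simpl; f_equal; ring).
  replace (- (2 * Ci) * p)%C with (0, - (2 * p))%R
    by (unfold Copp, Cmult, Ci, RtoC; simpl; f_equal; ring).
  unfold Cexp; simpl. rewrite cos_neg, sin_neg.
  unfold Copp, Cmult, Cplus, Ci, RtoC; simpl; rewrite exp_0; f_equal; ring.
Qed.

Lemma F_denom_real (p : R) : F_denom (RtoC p) = RtoC (1 + 2 * cos (2 * p)).
Proof.
unfold RtoC; rewrite F_denom_pair, Rmult_0_r.
unfold cosh, sinh. rewrite Ropp_0, exp_0. f_equal; field.
Qed.

(* The simple pole of [F] at [p] is cancelled by the zero of [h - h p]. *)
Lemma F_residual_bounded (h : C -> C) (p : R) (h' : C) :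
  is_Cderiv h (RtoC p) h' -> 1 + 2 * cos (2 * p) = 0 -> sin (2 * p) <> 0 ->
  exists r M, 0 < r /\ forall x y, Rabs (x - p) < r -> Rabs y < r ->
    x <> p \/ y <> 0 -> Cmod (F (x, y) * (h (x, y) + - h (RtoC p)))%C <= M.
Proof.
intros Hh Hp Hsin.
(* Half the modulus of the derivative of [F_denom] at its zero [p], so that [F_denom] is at least
   [k] times the distance to [p] nearby. *)
set (k := Rabs (- 4 * sin (2 * p)) / 2).
assert (Hk : 0 < k).
{ unfold k. apply Rmult_lt_0_compat; [|lra]. apply Rabs_pos_lt. lra. }
destruct (proj1 (is_Cderiv_eps h _ _) Hh 1 Rlt_0_1) as [d1 [D1 H1]].
destruct (proj1 (is_Cderiv_eps F_denom _ _) (is_Cderiv_F_denom p) k Hk)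
  as [d2 [D2 H2]].
rewrite F_denom_real, Hp in H2.
set (A := Cmod h' + 1).
exists (Rmin (Rmin d1 d2) 1 / 2), (4 * sqrt 3 * exp 1 * A / k); split.
{ apply Rmult_lt_0_compat; [|lra]. repeat apply Rmin_glb_lt; lra. }
intros x y Hx Hy Hxy.
pose proof (Rmin_l (Rmin d1 d2) 1). pose proof (Rmin_r (Rmin d1 d2) 1).
pose proof (Rmin_l d1 d2). pose proof (Rmin_r d1 d2).
set (w := (x - p, y) : C).
assert (Hw : Cmod w < Rmin (Rmin d1 d2) 1).
{ eapply Rle_lt_trans; [apply Cmod_le_Rabs|]. lra. }
assert (Ew : (RtoC p + w)%C = (x, y)).
{ unfold w, RtoC, Cplus; simpl; f_equal; ring. }
assert (Pw : 0 < Cmod w).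
{ apply Cmod_gt_0. intros E. unfold w, RtoC in E.
  injection E as E1 E2. destruct Hxy; lra. }
specialize (H1 w ltac:(lra)). specialize (H2 w ltac:(lra)). rewrite Ew in H1, H2.
assert (B1 : Cmod (h (x, y) + - h (RtoC p))%C <= A * Cmod w).
{ replace (h (x, y) + - h (RtoC p))%C
    with ((h (x, y) - h (RtoC p) - h' * w) + h' * w)%C by ring.
  eapply Rle_trans; [apply Cmod_triangle|]. rewrite Cmod_mult. unfold A. lra. }
assert (B2 : k * Cmod w <= Cmod (F_denom (x, y))).
{ pose proof (Cmod_triangle (F_denom (x, y))
    (- (F_denom (x, y) - 0 - RtoC (- 4 * sin (2 * p)) * w))%C) as T.
  rewrite Cmod_opp in T.
  replace (F_denom (x, y) + - (F_denom (x, y) - 0 - RtoC (- 4 * sin (2 * p)) * w))%C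
    with (RtoC (- 4 * sin (2 * p)) * w)%C in T by ring.
  rewrite Cmod_mult, Cmod_R in T.
  replace (Rabs (- 4 * sin (2 * p))) with (2 * k) in T by (unfold k; field). lra. }
assert (HD : 0 < Cmod (F_denom (x, y))) by nra.
rewrite Cmod_mult, Cmod_F by now apply Cmod_gt_0.
assert (B3 : Cmod (Ccos (x, y)) <= exp 1).
{ eapply Rle_trans; [apply Cmod_Ccos_le|]. eapply Rle_trans; [apply cosh_le_exp|].
  left; apply exp_increasing. lra. }
pose proof (sqrt_lt_R0 3 ltac:(lra)) as S3. pose proof (Cmod_ge_0 (Ccos (x, y))).
assert (PA : 0 < A) by (unfold A; pose proof (Cmod_ge_0 h'); lra).
apply Rle_trans with (4 * sqrt 3 * exp 1 / (k * Cmod w) * (A * Cmod w)).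
2:{ right; field; lra. }
apply Rmult_le_compat.
- apply Rdiv_le_0_compat; [nra|exact HD].
- apply Cmod_ge_0.
- apply Rmult_le_compat; [nra|left; now apply Rinv_0_lt_compat|nra|].
  apply Rinv_le_contravar; nra.
- exact B1.
Qed.

Lemma is_open_F_domain : is_open (fun z => F_denom z <> 0%C /\ left_plane z).
Proof.
intros z [Hz Hl].
destruct (proj1 (Ccontinuous_eps F_denom z)
  (holo_continuous (fun _ => True) F_denom z (holo_F_denom _) I)
  (Cmod (F_denom z)) ltac:(now apply Cmod_gt_0)) as [d [Hd H]].
unfold left_plane in *.
exists (Rmin d (PI / 3 - Re z)); split; [apply Rmin_glb_lt; lra|].
intros w Hw.
pose proof (Rmin_l d (PI / 3 - Re z)). pose proof (Rmin_r d (PI / 3 - Re z)).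
split.
- specialize (H w ltac:(lra)). intros E. rewrite E in H.
  replace (0 - F_denom z)%C with (- F_denom z)%C in H by ring.
  rewrite Cmod_opp in H. lra.
- pose proof (re_le_Cmod w) as T. apply Rabs_le_between in T.
  change (Re z + Re w < PI / 3). lra.
Qed.

Lemma holo_subset (U V : C -> Prop) (f : C -> C) :
  (forall z, U z -> V z) -> holo V f -> holo U f.
Proof. intros H [f' Hf]; exists f'; intros z Hz; apply Hf, H, Hz. Qed.

Lemma F_vline_exp_bounded (h : C -> C) (x K : R) :
  holo left_plane h -> x < PI / 3 -> 1 + 2 * cos (2 * x) <> 0 ->
  (forall y, Cmod (h (x, y)) <= K * exp (Rabs y / 2)) ->
  exists K', exp_bounded K' (fun y => F (x, y) * h (x, y))%C.
Proof.
intros Hh Hx Hc HK. destruct (Cmod_F_le x Hc) as [KF [KF0 HF]].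
exists (KF * K); split.
- intros t. apply (path_continuous_vline (fun z => F z * h z)%C).
  apply Ccontinuous_mult.
  + apply (holo_continuous _ F _ holo_F). apply F_denom_neq_0; now right.
  + apply (holo_continuous left_plane h _ Hh). exact Hx.
- intros t. rewrite Cmod_mult.
  replace (KF * K * exp (- (Rabs t / 2)))
    with (KF * exp (- Rabs t) * (K * exp (Rabs t / 2))).
  + apply Rmult_le_compat; auto using Cmod_ge_0.
  + transitivity (KF * K * (exp (- Rabs t) * exp (Rabs t / 2))); [ring|].
    rewrite <- exp_plus. do 2 f_equal. field.
Qed.

(** The strip may contain a pole: the threshold [T] is taken at least 1, where the bound on [F] is
    uniform in [x]. *)
Lemma F_strip_small (h : C -> C) (a b K : R) : 0 <= K ->
  (forall x y, a <= x <= b -> Cmod (h (x, y)) <= K * exp (Rabs y / 2)) ->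
  forall eps, 0 < eps -> exists T, forall x y, a < x < b -> T < Rabs y ->
    Cmod (F (x, y) * h (x, y))%C <= eps.
Proof.
intros K0 HK eps Heps.
pose proof (sqrt_lt_R0 3 ltac:(lra)) as S3.
destruct (exp_tail_small (8 * sqrt 3 * K) eps ltac:(nra) Heps) as [T [HT0 HT]].
exists (Rmax T 1). intros x y Hx Hy.
pose proof (Rmax_l T 1). pose proof (Rmax_r T 1).
rewrite Cmod_mult.
pose proof (Cmod_F_le_far x y ltac:(lra)) as BF.
pose proof (HK x y ltac:(lra)) as Bh.
apply Rle_trans with (8 * sqrt 3 * exp (- Rabs y) * (K * exp (Rabs y / 2))).
{ apply Rmult_le_compat; auto using Cmod_ge_0. }
replace (8 * sqrt 3 * exp (- Rabs y) * (K * exp (Rabs y / 2)))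
  with (8 * sqrt 3 * K * (exp (- Rabs y) * exp (Rabs y / 2))) by ring.
rewrite <- exp_plus. replace (- Rabs y + Rabs y / 2) with (- (Rabs y / 2)) by field.
assert (exp (- (Rabs y / 2)) <= exp (- (T / 2))) by (left; apply exp_increasing; lra).
pose proof (exp_pos (- (Rabs y / 2))).
assert (0 <= 8 * sqrt 3 * K) by nra. nra.
Qed.

(** By linearity, the equality of the two integrals of [F * (h - h p)] reads as stated; the residue
    contribution is [h p * (k1 - k2)], the jump of the integral of [F] itself times the value of
    [h]. *)
Lemma F_vline_cross (h : C -> C) (a b p x1 x2 K : R) (k1 k2 l1 l2 : C) :
  holo left_plane h -> a < x1 < p -> p < x2 < b -> b < PI / 3 ->
  1 + 2 * cos (2 * p) = 0 -> sin (2 * p) <> 0 ->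
  (forall x, a < x < b -> x <> p -> 1 + 2 * cos (2 * x) <> 0) ->
  (forall x y, a <= x <= b -> Cmod (h (x, y)) <= K * exp (Rabs y / 2)) ->
  sym_lim (fun y => F (x1, y)) k1 -> sym_lim (fun y => F (x2, y)) k2 ->
  sym_lim (fun y => F (x1, y) * h (x1, y))%C l1 ->
  sym_lim (fun y => F (x2, y) * h (x2, y))%C l2 ->
  (l1 - h (RtoC p) * k1)%C = (l2 - h (RtoC p) * k2)%C.
Proof.
intros Hh H1 H2 Hb Hp Hsin Hc HK S1 S2 T1 T2.
set (U := fun z => F_denom z <> 0%C /\ left_plane z).
set (f := fun z => (F z * (h z + - h (RtoC p)))%C).
assert (Hf : holo U f).
{ unfold f. apply holo_mult; [|apply holo_plus; [|apply holo_const]].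
  - apply holo_subset with (2 := holo_F). now intros z [Hz _].
  - apply holo_subset with (2 := Hh). now intros z [_ Hz]. }
assert (HU : forall x y, a < x < b -> x <> p \/ y <> 0 -> U (x, y)).
{ intros x y Hx Hxy. split; [|unfold left_plane; simpl; lra].
  apply F_denom_neq_0. destruct (Req_dec y 0) as [->|Hy]; [right|now left].
  apply Hc; tauto. }
assert (Hlim : forall x k l, x < PI / 3 -> 1 + 2 * cos (2 * x) <> 0 ->
  sym_lim (fun y => F (x, y)) k -> sym_lim (fun y => F (x, y) * h (x, y))%C l ->
  sym_lim (fun y => f (x, y)) (l - h (RtoC p) * k)%C).
{ intros x k l Hx Hcx Sk Sl.
  assert (CF : forall t, path_continuous (fun y => F (x, y)) t).
  { intros t. apply path_continuous_vline, (holo_continuous _ F _ holo_F).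
    apply F_denom_neq_0; now right. }
  assert (Ch : forall t, path_continuous (fun y => F (x, y) * h (x, y))%C t).
  { intros t. apply (path_continuous_vline (fun z => F z * h z)%C).
    apply Ccontinuous_mult.
    - apply (holo_continuous _ F _ holo_F). apply F_denom_neq_0; now right.
    - apply (holo_continuous left_plane h _ Hh). exact Hx. }
  pose proof (sym_lim_plus _ (fun y => - h (RtoC p) * F (x, y))%C _ _ Ch
    ltac:(intros t; apply (path_continuous_vline (fun z => - h (RtoC p) * F z)%C);
      apply Ccontinuous_mult; [apply Ccontinuous_const|];
      apply (holo_continuous _ F _ holo_F), F_denom_neq_0; now right)
    Sl (sym_lim_Cmult (- h (RtoC p))%C _ k CF Sk)) as S.
  replace (l - h (RtoC p) * k)%C with (l + - h (RtoC p) * k)%C by ring.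
  intros eps Heps. destruct (S eps Heps) as [T0 HT]. exists T0; intros T HT'.
  specialize (HT T HT').
  rewrite (RInt_ext (V := C_R_CompleteNormedModule) (fun y => f (x, y))
    (fun y => F (x, y) * h (x, y) + - h (RtoC p) * F (x, y))%C); [exact HT|].
  intros y _. unfold f.
  change (F (x, y) * (h (x, y) + - h (RtoC p))
    = F (x, y) * h (x, y) + - h (RtoC p) * F (x, y))%C. ring. }
apply (vline_shift U f a b p x1 x2); auto.
- exact is_open_F_domain.
- destruct Hh as [h' Hh]. apply (F_residual_bounded h p (h' (RtoC p))); auto.
  apply Hh. unfold left_plane; simpl. lra.
- intros eps Heps.
  set (Q := K + Cmod (h (RtoC p))).
  assert (K0 : 0 <= K).
  { pose proof (HK p 0 ltac:(lra)) as T. pose proof (Cmod_ge_0 (h (p, 0))).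
    pose proof (exp_pos (Rabs 0 / 2)). nra. }
  assert (Q0 : 0 <= Q) by (unfold Q; pose proof (Cmod_ge_0 (h (RtoC p))); lra).
  apply (F_strip_small (fun z => h z + - h (RtoC p))%C a b Q Q0); [|exact Heps].
  intros x y Hx. eapply Rle_trans; [apply Cmod_triangle|]. rewrite Cmod_opp. unfold Q.
  pose proof (HK x y ltac:(lra)).
  assert (1 <= exp (Rabs y / 2)).
  { pose proof (exp_ineq1_le (Rabs y / 2)). pose proof (Rabs_pos y). lra. }
  pose proof (Cmod_ge_0 (h (RtoC p))). nra.
- apply Hlim; auto; [lra|apply Hc; lra].
- apply Hlim; auto; [lra|apply Hc; lra].
Qed.

(** * Integrals of [F] over vertical lines *)

Lemma sym_lim_ext (f g : R -> C) (l : C) :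
  (forall t, f t = g t) -> sym_lim f l -> sym_lim g l.
Proof.
intros E H eps Heps. destruct (H eps Heps) as [T0 HT]. exists T0; intros T HT'.
rewrite <- (RInt_ext (V := C_R_CompleteNormedModule) f g) by (intros; apply E).
now apply HT.
Qed.

Lemma F_imaginary_axis (y : R) :
  F (0, y) = ((- (4 * sqrt 3 * cosh y / (3 + 4 * (sinh y * sinh y))))%R : C).
Proof.
pose proof (cosh2_sinh2 y) as H. pose proof (Rle_0_sqr (sinh y)) as H0. unfold Rsqr in H0.
assert (E : F_denom (0, y) = RtoC (3 + 4 * (sinh y * sinh y))).
{ rewrite F_denom_pair, Rmult_0_r, cos_0, sin_0. unfold RtoC; f_equal; [|ring].
  replace (cosh (2 * y)) with (cosh y * cosh y + sinh y * sinh y); [lra|].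
  unfold cosh, sinh. replace (2 * y) with (y + y) by ring.
  replace (- (y + y)) with (- y + - y) by ring. rewrite !exp_plus.
  field. }
unfold F. fold (F_denom (0, y)). rewrite E, Ccos_pair, cos_0, sin_0.
replace (1 * cosh y, - (0 * sinh y)) with (RtoC (cosh y))
  by (unfold RtoC; f_equal; ring).
rewrite <- !RtoC_mult, <- RtoC_div, <- RtoC_opp by lra. reflexivity.
Qed.

Lemma is_derive_sinh (y : R) : is_derive sinh y (cosh y).
Proof. apply is_derive_Reals, derivable_pt_lim_sinh. Qed.

(** On this line [F] is real with primitive [- 2 atan (2 sinh y / sqrt 3)]. *)
Lemma CRInt_F_imaginary_axis (T : R) :
  is_CRInt (fun y => F (0, y)) (- T) T (RtoC (- (4 * atan (2 * sinh T / sqrt 3)))).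
Proof.
pose proof (sqrt_lt_R0 3 ltac:(lra)) as S3. pose proof (sqrt_sqrt 3 ltac:(lra)) as S33.
apply (is_RInt_ext (V := C_R_NormedModule)
  (fun y => RtoC (- (4 * sqrt 3 * cosh y / (3 + 4 * (sinh y * sinh y)))))).
{ intros y _. now rewrite F_imaginary_axis. }
apply is_CRInt_pair; simpl; split.
2:{ pose proof (is_RInt_const (V := R_NormedModule) (- T) T 0) as H.
    change (scal (T - - T) 0) with ((T - - T) * 0) in H.
    now rewrite Rmult_0_r in H. }
assert (E : sinh (- T) = - sinh T) by (unfold sinh; rewrite Ropp_involutive; field).
replace (- (4 * atan (2 * sinh T / sqrt 3))) with
  (minus (- (2 * atan (2 * sinh T / sqrt 3))) (- (2 * atan (2 * sinh (- T) / sqrt 3)))).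
2:{ rewrite E. replace (2 * - sinh T / sqrt 3) with (- (2 * sinh T / sqrt 3)) by (field; lra).
    rewrite atan_opp. unfold minus, plus, opp; simpl. ring. }
apply (is_RInt_derive (V := R_CompleteNormedModule)
  (fun y => - (2 * atan (2 * sinh y / sqrt 3)))).
- intros y _. pose proof (Rle_0_sqr (sinh y)) as H0. unfold Rsqr in H0.
  replace (- (4 * sqrt 3 * cosh y / (3 + 4 * (sinh y * sinh y))))
    with (- (2 * (2 / sqrt 3 * cosh y * / (1 + Rsqr (2 / sqrt 3 * sinh y))))).
  2:{ unfold Rsqr.
      replace (2 / sqrt 3 * sinh y * (2 / sqrt 3 * sinh y))
        with (4 / (sqrt 3 * sqrt 3) * (sinh y * sinh y)) by (field; lra).
      rewrite S33. 
      replace (sqrt 3) with (3 / sqrt 3) at 2 by (rewrite <- S33 at 1; field; lra).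
      field; split; lra. }
  apply (is_derive_opp (V := R_NormedModule)), is_derive_scal.
  apply (is_derive_ext (fun y => atan (2 / sqrt 3 * sinh y))).
  { intros t. f_equal. unfold Rdiv; ring. }
  apply (is_derive_comp (V := R_NormedModule) atan (fun y => 2 / sqrt 3 * sinh y)).
  + apply is_derive_atan.
  + apply is_derive_scal, is_derive_sinh.
- intros y _. pose proof (Rle_0_sqr (sinh y)) as H0. unfold Rsqr in H0.
  apply (ex_derive_continuous
    (fun y => - (4 * sqrt 3 * cosh y / (3 + 4 * (sinh y * sinh y))))).
  unfold sinh, cosh. auto_derive.
  change ((exp y + - exp (- y)) * / 2) with (sinh y). lra.
Qed.

Lemma sinh_ge_half (T : R) : 0 <= T -> T / 2 <= sinh T.
Proof.
intros HT. unfold sinh. pose proof (exp_ineq1_le T).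
assert (exp (- T) <= 1).
{ rewrite <- exp_0. destruct HT as [HT| <-]; [left; apply exp_increasing; lra|].
  rewrite Ropp_0; lra. }
lra.
Qed.

Lemma sym_lim_F_0 : sym_lim (fun y => F (0, y)) (- (2 * PI))%R.
Proof.
intros eps Heps. pose proof PI_RGT_0 as HPI.
pose proof (sqrt_lt_R0 3 ltac:(lra)) as S3.
(* Chosen with [4 * (PI / 2 - t) <= eps]; the arctangent exceeds [t] once [2 * sinh T], which is at
   least [T], passes [sqrt 3 * tan t]. *)
set (t := Rmax 0 (PI / 2 - eps / 4)).
assert (Ht : 0 <= t < PI / 2) by (unfold t, Rmax; destruct Rle_dec; lra).
exists (Rmax 0 (sqrt 3 * tan t)). intros T HT.
pose proof (Rmax_l 0 (sqrt 3 * tan t)). pose proof (Rmax_r 0 (sqrt 3 * tan t)).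
rewrite (CRInt_unique _ _ _ _ (CRInt_F_imaginary_axis T)).
rewrite <- RtoC_minus, Cmod_R.
assert (H1 : tan t < 2 * sinh T / sqrt 3).
{ apply Rmult_lt_reg_l with (sqrt 3); [exact S3|].
  replace (sqrt 3 * (2 * sinh T / sqrt 3)) with (2 * sinh T) by (field; lra).
  pose proof (sinh_ge_half T ltac:(lra)). lra. }
apply atan_increasing in H1. rewrite atan_tan in H1 by lra.
pose proof (atan_bound (2 * sinh T / sqrt 3)).
assert (PI / 2 - eps / 4 <= t) by apply Rmax_r.
apply Rabs_lt_between. lra.
Qed.

Lemma F_minus_PI (x y : R) : F (x - PI, y) = (- F (x, y))%C.
Proof.
unfold F. fold (F_denom (x - PI, y)) (F_denom (x, y)).
rewrite !F_denom_pair, !Ccos_pair.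
replace (2 * (x - PI)) with (2 * x - 2 * PI) by ring.
rewrite !cos_minus, !sin_minus, cos_2PI, sin_2PI, cos_PI, sin_PI.
replace (cos (2 * x) * 1 + sin (2 * x) * 0) with (cos (2 * x)) by ring.
replace (sin (2 * x) * 1 - cos (2 * x) * 0) with (sin (2 * x)) by ring.
replace ((cos x * -1 + sin x * 0) * cosh y, - ((sin x * -1 - cos x * 0) * sinh y))
  with (- (cos x * cosh y, - (sin x * sinh y))%R)%C
  by (unfold Copp; simpl; f_equal; ring).
unfold Cdiv; ring.
Qed.

(** On this line [F] is odd in [y], so every symmetric integral is equal to its own opposite. *)
Lemma sym_lim_F_half_PI : sym_lim (fun y => F (- (PI / 2), y)) 0.
Proof.
intros eps Heps. exists 0; intros T HT.
set (f := fun y => F (- (PI / 2), y)).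
assert (Hodd : forall y, f (- y) = (- f y)%C).
{ intros y. unfold f, F. fold (F_denom (- (PI / 2), - y)) (F_denom (- (PI / 2), y)).
  rewrite !F_denom_pair, !Ccos_pair.
  replace (2 * - (PI / 2)) with (- PI) by field.
  rewrite !sin_neg, !cos_neg, cos_PI2, sin_PI2, cos_PI, sin_PI.
  assert (Hs : sinh (- y) = - sinh y) by (unfold sinh; rewrite Ropp_involutive; field).
  assert (Hc : cosh (2 * - y) = cosh (2 * y)).
  { replace (2 * - y) with (- (2 * y)) by ring.
    unfold cosh; rewrite Ropp_involutive; field. }
  rewrite Hs, Hc, !Rmult_0_l, Ropp_0, !Rmult_0_l.
  replace (0, - (- (1) * - sinh y)) with (- (0, - (- (1) * sinh y))%R)%C
    by (unfold Copp; simpl; f_equal; ring).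
  unfold Cdiv; ring. }
assert (Hc : forall t, path_continuous f t).
{ intros t. apply path_continuous_vline, (holo_continuous _ F _ holo_F).
  apply F_denom_neq_0; right.
  replace (2 * - (PI / 2)) with (- PI) by field. rewrite cos_neg, cos_PI. lra. }
pose proof (CRInt_correct f (- T) T (ex_CRInt_continuous f _ _ Hc)) as H.
set (l := CRInt f (- T) T) in *.
assert (H' : is_CRInt f (- T) T (- l)%C).
{ pose proof (is_RInt_comp_opp (V := C_R_NormedModule) f (- T) T (- l)%C) as Q.
  rewrite Ropp_involutive in Q.
  pose proof (is_RInt_swap (V := C_R_NormedModule) f T (- T) l H) as S.
  apply is_RInt_ext with (f := fun y => opp (f (- y))).
  { intros y _. rewrite Hodd. change (- - f y = f y)%C. ring. }
  exact (Q S). }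
apply CRInt_unique in H'. fold l in H'. fold l.
enough (E : l = RtoC 0) by (rewrite E; replace (0 - 0)%C with (RtoC 0) by ring;
  now rewrite Cmod_0).
clearbody l. revert H'; destruct l as [l1 l2]; intros H'.
injection H' as E1 E2. unfold RtoC; f_equal; lra.
Qed.

(** * Crossing two poles *)

(** [hpow s m z] is [u (z - m * PI)] to the power [- s]. *)
Definition hpow (s : C) (m : nat) (z : C) : C :=
  Cexp (- s * ell (z + - RtoC (INR m * PI)))%C.

Lemma hpow_shift_left (m : nat) (z : C) :
  left_plane z -> left_plane (z + - RtoC (INR m * PI))%C.
Proof.
unfold left_plane; destruct z as [x y]; simpl; intros H.
pose proof (pos_INR m). pose proof PI_RGT_0. nra.
Qed.

Lemma hpow_eq (s : C) (m : nat) (z : C) : left_plane z ->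
  hpow s m z = Ccpow (u (z + - RtoC (INR m * PI))%C) (- s)%C.
Proof.
intros Hz. unfold hpow, Ccpow. now rewrite Clog_u by now apply hpow_shift_left.
Qed.

Lemma holo_hpow (s : C) (m : nat) : holo left_plane (hpow s m).
Proof.
unfold hpow.
apply (holo_comp left_plane (fun _ => True) (fun z => - s * ell (z + - RtoC (INR m * PI)))%C
  Cexp); [auto| |apply holo_Cexp].
apply holo_mult; [apply holo_const|].
apply (holo_comp left_plane left_plane (fun z => z + - RtoC (INR m * PI))%C ell);
[apply hpow_shift_left| |apply holo_ell].
apply holo_plus; [apply holo_id|apply holo_const].
Qed.

Lemma exp_le_compat (x y : R) : x <= y -> exp x <= exp y.
Proof. intros [H| ->]; [left; now apply exp_increasing|right; reflexivity]. Qed.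

Lemma hpow_growth (s : C) (m : nat) (a b : R) : b < PI / 3 ->
  exists K, forall x y, a <= x <= b -> Cmod (hpow s m (x, y)) <= K * exp (Rabs y / 2).
Proof.
intros Hb. pose proof (pos_INR m) as Hm. pose proof PI_RGT_0 as HPI.
destruct (Cmod_ell_le (Cmod s) (a - INR m * PI) (b - INR m * PI)
  (Cmod_ge_0 s) ltac:(nra)) as [B HB].
exists (exp B); intros x y Hx. unfold hpow.
replace ((x, y) + - RtoC (INR m * PI))%C with (x - INR m * PI, y)%R
  by (unfold RtoC, Cplus, Copp; simpl; f_equal; ring).
rewrite Cmod_Cexp, <- exp_plus. apply exp_le_compat.
eapply Rle_trans; [apply Rle_abs|]. eapply Rle_trans; [apply re_le_Cmod|].
rewrite Cmod_mult, Cmod_opp. apply HB. lra.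
Qed.

Lemma F_hpow_exp_bounded (s : C) (m : nat) (x : R) :
  x < PI / 3 -> 1 + 2 * cos (2 * x) <> 0 ->
  exists K, exp_bounded K (fun y => F (x, y) * hpow s m (x, y))%C.
Proof.
intros Hx Hc. destruct (hpow_growth s m x x Hx) as [K HK].
apply (F_vline_exp_bounded (hpow s m) x K); auto using holo_hpow.
intros y; apply HK; lra.
Qed.

Lemma F_hpow_sym_lim (s : C) (m : nat) (x : R) :
  x < PI / 3 -> 1 + 2 * cos (2 * x) <> 0 ->
  exists l, sym_lim (fun y => F (x, y) * hpow s m (x, y))%C l.
Proof.
intros Hx Hc. destruct (F_hpow_exp_bounded s m x Hx Hc) as [K HK].
destruct (ex_line_int K _ HK) as [l Hl].
exists l. now apply line_int_sym_lim.
Qed.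

(** The left side is [2 (cos (2 x) - cos (2 p))]. The factored form shows that [p] is the only zero
    in a strip from the sign of sines alone. *)
Lemma one_plus_2cos (x p : R) : 1 + 2 * cos (2 * p) = 0 ->
  1 + 2 * cos (2 * x) = - 4 * (sin (x + p) * sin (x - p)).
Proof.
intros Hp.
rewrite sin_plus, sin_minus. rewrite !cos_2a in *.
pose proof (sin2_cos2 x) as Hx. pose proof (sin2_cos2 p) as Hq. unfold Rsqr in *.
nra.
Qed.

Lemma hpow_cross (s : C) (m : nat) (l l' : C) :
  sym_lim (fun y => F (0, y) * hpow s m (0, y))%C l ->
  sym_lim (fun y => F (0, y) * hpow s (S m) (0, y))%C l' ->
  l = (- RtoC (2 * PI) * (hpow s m (RtoC (- (PI / 3))) + hpow s m (RtoC (- (2 * (PI / 3)))))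
       - l')%C.
Proof.
intros Hl Hl'. pose proof PI_RGT_0 as HPI.
assert (P1 : 1 + 2 * cos (2 * - (PI / 3)) = 0).
{ replace (2 * - (PI / 3)) with (- (2 * (PI / 3))) by ring.
  rewrite cos_neg, cos_2PI3. field. }
assert (P2 : 1 + 2 * cos (2 * - (2 * (PI / 3))) = 0).
{ replace (2 * - (2 * (PI / 3))) with (- (PI / 3 + PI)) by field.
  rewrite cos_neg, neg_cos, cos_PI3. field. }
assert (Hhalf : 1 + 2 * cos (2 * - (PI / 2)) <> 0).
{ replace (2 * - (PI / 2)) with (- PI) by field. rewrite cos_neg, cos_PI. lra. }
destruct (F_hpow_sym_lim s m (- (PI / 2)) ltac:(lra) Hhalf) as [lh Hlh].
(* [hpow s m (z - PI) = hpow s (S m) z] and [F] changes sign, so the line at [- PI] for [m] is the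
   line at [0] for [S m]. *)
assert (Hpi : sym_lim (fun y => F (- PI, y)%R * hpow s m (- PI, y)%R)%C (- l')%C).
{ replace (- l')%C with (- (1) * l')%C by ring.
  apply (sym_lim_ext (fun y => - (1) * (F (0, y) * hpow s (S m) (0, y)))%C).
  - intros y. replace (- PI) with (0 - PI) by ring. rewrite F_minus_PI.
    replace (hpow s m (0 - PI, y)%R) with (hpow s (S m) (0, y)); [ring|].
    unfold hpow. do 2 f_equal. f_equal.
    rewrite S_INR. unfold RtoC, Cplus, Copp; simpl; f_equal; ring.
  - apply sym_lim_Cmult; [|exact Hl'].
    destruct (F_hpow_exp_bounded s (S m) 0 ltac:(lra)
      ltac:(rewrite Rmult_0_r, cos_0; lra)) as [K [HK _]]. exact HK. }
assert (Kpi : sym_lim (fun y => F (- PI, y)) (RtoC (2 * PI))).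
{ replace (RtoC (2 * PI)) with (- (1) * RtoC (- (2 * PI)))%C
    by (unfold RtoC, Cmult, Copp; simpl; f_equal; ring).
  apply (sym_lim_ext (fun y => - (1) * F (0, y))%C).
  - intros y. replace (- PI) with (0 - PI) by ring. rewrite F_minus_PI. ring.
  - apply sym_lim_Cmult; [|exact sym_lim_F_0].
    intros t. apply path_continuous_vline, (holo_continuous _ F _ holo_F).
    apply F_denom_neq_0; right. rewrite Rmult_0_r, cos_0; lra. }
(* Two overlapping strips: the first contains the lines [- PI / 2] and [0] and only the pole
   [- PI / 3], the second the lines [- PI] and [- PI / 2] and only the pole [- 2 PI / 3]. *)
destruct (hpow_growth s m (- (7 * PI / 12)) (PI / 6) ltac:(lra)) as [Ka HKa].
destruct (hpow_growth s m (- (7 * PI / 6)) (- (5 * PI / 12)) ltac:(lra)) as [Kb HKb].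
assert (S1 : sin (2 * - (PI / 3)) <> 0).
{ replace (2 * - (PI / 3)) with (- (2 * (PI / 3))) by ring.
  rewrite sin_neg. assert (0 < sin (2 * (PI / 3))) by (apply sin_gt_0; lra). lra. }
assert (S2 : sin (2 * - (2 * (PI / 3))) <> 0).
{ replace (2 * - (2 * (PI / 3))) with (- (PI / 3 + PI)) by field.
  rewrite sin_neg, neg_sin. assert (0 < sin (PI / 3)) by (apply sin_gt_0; lra). lra. }
assert (Hsin : forall t, - PI < t < PI -> t <> 0 -> sin t <> 0).
{ intros t Ht Ht0. destruct (Rtotal_order t 0) as [H|[H|H]]; [|contradiction|].
  - assert (0 < sin (- t)) by (apply sin_gt_0; lra). rewrite sin_neg in *. lra.
  - assert (0 < sin t) by (apply sin_gt_0; lra). lra. }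
pose proof (F_vline_cross (hpow s m) (- (7 * PI / 12)) (PI / 6) (- (PI / 3))
  (- (PI / 2)) 0 Ka 0 (RtoC (- (2 * PI))) lh l (holo_hpow s m)
  ltac:(lra) ltac:(lra) ltac:(lra) P1 S1
  ltac:(intros x Hx Hxp; rewrite (one_plus_2cos x _ P1);
    pose proof (Hsin (x + - (PI / 3)) ltac:(lra) ltac:(lra));
    pose proof (Hsin (x - - (PI / 3)) ltac:(lra) ltac:(lra)); nra)
  HKa sym_lim_F_half_PI sym_lim_F_0 Hlh Hl) as E1.
assert (Hsin2 : forall t, - (2 * PI) < t < - PI -> sin t <> 0).
{ intros t Ht. assert (0 < sin (- t - PI)) by (apply sin_gt_0; lra).
  replace t with (- ((- t - PI) + PI)) by ring. rewrite sin_neg, neg_sin. lra. }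
pose proof (F_vline_cross (hpow s m) (- (7 * PI / 6)) (- (5 * PI / 12)) (- (2 * (PI / 3)))
  (- PI) (- (PI / 2)) Kb (RtoC (2 * PI)) 0 (- l')%C lh (holo_hpow s m)
  ltac:(lra) ltac:(lra) ltac:(lra) P2 S2
  ltac:(intros x Hx Hxp; rewrite (one_plus_2cos x _ P2);
    pose proof (Hsin2 (x + - (2 * (PI / 3))) ltac:(lra));
    pose proof (Hsin (x - - (2 * (PI / 3))) ltac:(lra) ltac:(lra)); nra)
  HKb Kpi sym_lim_F_half_PI Hpi Hlh) as E2.
revert E1 E2. rewrite (RtoC_opp (2 * PI)).
generalize (hpow s m (RtoC (- (PI / 3)))) (hpow s m (RtoC (- (2 * (PI / 3))))).
intros h1 h2 E1 E2.
replace l with (l - h1 * - RtoC (2 * PI) + h1 * - RtoC (2 * PI))%C by ring.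
rewrite <- E1.
(* The crossings are glued on the middle line, where [F] integrates to zero and the value of [h] at
   either pole drops out. *)
replace (lh - h1 * 0)%C with (lh - h2 * 0)%C by ring.
rewrite <- E2. ring.
Qed.

(** After translation by [m * PI] the two poles are the lattice points of index [- (3 m + 1)] and
    [- (3 m + 2)], where [u] equals [(3 m + 2) (3 m + 3) / 6] and [(3 m + 3) (3 m + 4) / 6]. *)
Lemma hpow_pent (s : C) (m : nat) :
  hpow s m (RtoC (- (PI / 3))) = Ccpow (INR (pent_lo m)) (- s)%C /\
  hpow s m (RtoC (- (2 * (PI / 3)))) = Ccpow (INR (pent_hi m)) (- s)%C.
Proof.
pose proof PI_RGT_0 as HPI.
assert (HT : 2 * INR (triangular m) = INR m * (INR m + 1)).
{ induction m as [|m IH]; [simpl; ring|].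
  cbn [triangular]. rewrite plus_INR, Rmult_plus_distr_l, IH, !S_INR. ring. }
assert (E : forall x : R, u (RtoC x) = RtoC ((PI - 3 * x) * (2 * PI - 3 * x) / (6 * PI ^ 2))).
{ intros x. unfold u. rewrite RtoC_div, !RtoC_mult, !RtoC_minus, !RtoC_mult, RtoC_pow;
  [reflexivity|]. apply Rmult_integral_contrapositive_currified; [lra|].
  apply pow_nonzero; lra. }
rewrite !hpow_eq by (unfold left_plane; simpl; lra).
rewrite <- RtoC_opp, <- !RtoC_plus, !E.
unfold pent_lo, pent_hi; cbn [triangular].
rewrite !plus_INR, !mult_INR, !S_INR.
replace (INR (triangular m)) with (INR m * (INR m + 1) / 2) by lra.
split; do 2 f_equal; field; lra.
Qed.

(** * The continuation *)

Lemma Cmod_ge_Re (r : R) (z : C) : r <= Re z -> r <= Cmod z.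
Proof.
intros H. eapply Rle_trans; [exact H|].
eapply Rle_trans; [apply Rle_abs|apply re_le_Cmod].
Qed.

(** For [x <= 0] both translated factors have modulus at least [PI * (1 + 3 m)], so [Re ell] tends
    to infinity with [m] uniformly, while [Im ell] stays within [PI]. With [Re s] positive the
    exponent tends to minus infinity. *)
Lemma hpow_small (s : C) : 0 < Re s -> forall eps, 0 < eps ->
  exists M, forall m x y, (M <= m)%nat -> x <= 0 -> Cmod (hpow s m (x, y)) <= eps.
Proof.
intros Hs eps Heps. pose proof PI_RGT_0 as HPI.
set (c0 := ln (6 * PI ^ 2)).
(* Solves [Re s * (2 * Y - c0) = Rabs (Im s) * PI - ln eps], where [2 * Y - c0] is the lower bound
   for [Re ell] once both logarithms exceed [Y]. *)
set (Y := ((Rabs (Im s) * PI - ln eps) / Re s + c0) / 2).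
destruct (INR_unbounded (exp Y)) as [M HM].
exists M; intros m x y Hm Hx.
assert (Hq : exp Y < PI * (1 + 3 * INR m)).
{ apply le_INR in Hm. pose proof (pos_INR m). pose proof PI2_1.
  nra. }
apply ln_increasing in Hq; [|apply exp_pos]. rewrite ln_exp in Hq.
unfold hpow. rewrite Cmod_Cexp, <- (exp_ln eps) by exact Heps. apply exp_le_compat.
set (z := ((x, y) + - RtoC (INR m * PI))%C).
assert (Hz : Re z = x - INR m * PI) by (unfold z; simpl; ring).
pose proof (pos_INR m) as Pm.
assert (q0 : 0 < PI * (1 + 3 * INR m)) by nra.
assert (L1 : ln (PI * (1 + 3 * INR m)) <= ln (Cmod (PI - 3 * z)%C)).
{ apply ln_le; [exact q0|]. apply Cmod_ge_Re.
  replace (Re (PI - 3 * z)%C) with (PI - 3 * Re z) by (simpl; ring). rewrite Hz. nra. }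
assert (L2 : ln (PI * (1 + 3 * INR m)) <= ln (Cmod (2 * PI - 3 * z)%C)).
{ apply ln_le; [exact q0|]. apply Cmod_ge_Re.
  replace (Re (2 * PI - 3 * z)%C) with (2 * PI - 3 * Re z) by (simpl; ring).
  rewrite Hz. nra. }
assert (E1 : 2 * Y - c0 <= Re (ell z)).
{ unfold ell, Lg. cbn [Re Im Cplus Copp RtoC fst snd]. fold c0. lra. }
assert (E2 : Rabs (Im (ell z)) <= PI).
{ unfold ell, Lg. cbn [Re Im Cplus Copp RtoC fst snd].
  match goal with |- Rabs (atan ?a + atan ?b + _) <= _ =>
    pose proof (atan_bound a); pose proof (atan_bound b) end.
  apply Rabs_le; lra. }
replace (Re (- s * ell z)%C) with (- Re s * Re (ell z) + Im s * Im (ell z))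
  by (generalize (ell z); intros []; destruct s; simpl; ring).
assert (E3 : Im s * Im (ell z) <= Rabs (Im s) * PI).
{ eapply Rle_trans; [apply Rle_abs|]. rewrite Rabs_mult.
  apply Rmult_le_compat_l; [apply Rabs_pos|exact E2]. }
assert (E4 : Re s * (2 * Y - c0) = Rabs (Im s) * PI - ln eps) by (unfold Y; field; lra).
assert (E5 : Re s * (2 * Y - c0) <= Re s * Re (ell z)) by (apply Rmult_le_compat_l; lra).
lra.
Qed.

Lemma F_hpow_lim_small (s : C) : 0 < Re s -> forall eps, 0 < eps ->
  exists M, forall m l, (M <= m)%nat ->
    sym_lim (fun y => F (0, y) * hpow s m (0, y))%C l -> Cmod l <= eps.
Proof.
intros Hs eps Heps. pose proof PI_RGT_0 as HPI.
assert (Hc : 1 + 2 * cos (2 * 0) <> 0) by (rewrite Rmult_0_r, cos_0; lra).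
destruct (Cmod_F_le 0 Hc) as [KF [KF0 HF]].
destruct (hpow_small s Hs (eps / (4 * (KF + 1)))) as [M HM].
{ apply Rdiv_lt_0_compat; lra. }
exists M; intros m l Hm Hl.
destruct (F_hpow_exp_bounded s m 0 ltac:(lra) Hc) as [K [HK _]].
assert (HB : exp_bounded (KF * (eps / (4 * (KF + 1))))
  (fun y => F (0, y) * hpow s m (0, y))%C).
{ split; [exact HK|]. intros t. rewrite Cmod_mult.
  replace (KF * (eps / (4 * (KF + 1))) * exp (- (Rabs t / 2)))
    with (KF * exp (- (Rabs t / 2)) * (eps / (4 * (KF + 1)))) by ring.
  apply Rmult_le_compat; auto using Cmod_ge_0.
  - eapply Rle_trans; [apply HF|]. apply Rmult_le_compat_l; [exact KF0|].
    apply exp_le_compat. pose proof (Rabs_pos t). lra.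
  - apply HM; [exact Hm|lra]. }
eapply Rle_trans; [exact (sym_lim_Cmod_le _ _ _ HB Hl)|].
apply Rmult_le_reg_r with (KF + 1); [lra|].
replace (4 * (KF * (eps / (4 * (KF + 1)))) * (KF + 1)) with (KF * eps) by (field; lra).
nra.
Qed.

Lemma F_hpow_series (s l : C) : 0 < Re s ->
  sym_lim (fun y => F (0, y) * hpow s 0 (0, y))%C l ->
  is_dirichlet_series euler_coeff s (RtoC (/ (2 * PI)) * l)%C.
Proof.
intros Hs Hl. pose proof PI_RGT_0 as HPI.
assert (Hc : 1 + 2 * cos (2 * 0) <> 0) by (rewrite Rmult_0_r, cos_0; lra).
set (g := fun n => Ccpow (INR n) (- s)%C).
(* State after [m] crossings. The sign change of [F] under translation by [PI] alternates the
   remainder and thereby produces the signs of Euler's coefficients. *)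
assert (Hrec : forall m, exists lm,
  sym_lim (fun y => F (0, y) * hpow s m (0, y))%C lm /\
  l = (RtoC (2 * PI) * pent_sum g m + IZR (Zsign m) * lm)%C).
{ induction m as [|m [lm [Hm E]]].
  - exists l; split; [exact Hl|]. change (IZR (Zsign 0)) with 1. cbn [pent_sum]. ring.
  - destruct (F_hpow_sym_lim s (S m) 0 ltac:(lra) Hc) as [l' Hl'].
    exists l'; split; [exact Hl'|].
    pose proof (hpow_cross s m lm l' Hm Hl') as X.
    destruct (hpow_pent s m) as [Elo Ehi]. rewrite Elo, Ehi in X.
    rewrite E, X. cbn [pent_sum]. unfold g.
    rewrite Zsign_S, opp_IZR, RtoC_opp. ring. }
apply (pent_series g).
intros eps Heps.
destruct (hpow_small s Hs (eps / 2) ltac:(lra)) as [M1 H1].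
destruct (F_hpow_lim_small s Hs (eps / 2) ltac:(lra)) as [M2 H2].
exists (max M1 M2); intros m Hm. split.
- destruct (Hrec m) as [lm [Hlm E]].
  specialize (H2 m lm ltac:(lia) Hlm).
  replace (pent_sum g m - RtoC (/ (2 * PI)) * l)%C
    with (- (RtoC (/ (2 * PI)) * (IZR (Zsign m) * lm)))%C.
  2:{ rewrite E, RtoC_inv by lra. field. intros E'; apply RtoC_inj in E'; lra. }
  rewrite Cmod_opp, !Cmod_mult, !Cmod_R.
  replace (Rabs (IZR (Zsign m))) with 1
    by (unfold Zsign; destruct Nat.even; simpl; unfold Rabs; destruct Rcase_abs; lra).
  assert (Hi : 0 < / (2 * PI) < 1).
  { pose proof PI2_1. split; [apply Rinv_0_lt_compat; lra|].
    rewrite <- Rinv_1. apply Rinv_lt_contravar; lra. }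
  rewrite Rabs_pos_eq by lra. pose proof (Cmod_ge_0 lm). nra.
(* A single term is the value of [hpow s m] at a pole, so the bound used for the remainder covers it
   too. *)
- unfold g. rewrite <- (proj1 (hpow_pent s m)).
  specialize (H1 m (- (PI / 3)) 0 ltac:(lia) ltac:(lra)).
  unfold RtoC. lra.
Qed.

(** * Independence of the abscissa [c] *)

Lemma one_plus_2cos_neq_0 (c : R) : - (PI / 3) < c < PI / 3 -> 1 + 2 * cos (2 * c) <> 0.
Proof.
intros Hc.
assert (Hk : forall x, 0 <= x < PI / 3 -> - (1 / 2) < cos (2 * x)).
{ intros x Hx. replace (- (1 / 2)) with (cos (2 * (PI / 3))) by (rewrite cos_2PI3; field).
  apply cos_decreasing_1; lra. }
destruct (Rle_dec 0 c).
- pose proof (Hk c ltac:(lra)). lra.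
- pose proof (Hk (- c) ltac:(lra)).
  replace (2 * - c) with (- (2 * c)) in H by ring. rewrite cos_neg in H. lra.
Qed.

(** No pole lies between the lines; [vline_shift] is applied with the midpoint as a fictitious
    puncture, near which the integrand is bounded by continuity. *)
Lemma F_hpow_lim_lt (s : C) (x1 x2 : R) (l1 l2 : C) :
  - (PI / 3) < x1 -> x1 < x2 -> x2 < PI / 3 ->
  sym_lim (fun y => F (x1, y) * hpow s 0 (x1, y))%C l1 ->
  sym_lim (fun y => F (x2, y) * hpow s 0 (x2, y))%C l2 -> l1 = l2.
Proof.
intros H1 H12 H2 S1 S2.
set (a := (- (PI / 3) + x1) / 2). set (b := (x2 + PI / 3) / 2).
assert (Hb : b < PI / 3) by (unfold b; lra).
assert (Hin : forall x y, a < x < b -> F_denom (x, y) <> 0%C /\ left_plane (x, y)).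
{ intros x y Hx. unfold a, b in Hx. split.
  - apply F_denom_neq_0; right. apply one_plus_2cos_neq_0. lra.
  - unfold left_plane; simpl; lra. }
assert (Hf : holo (fun z => F_denom z <> 0%C /\ left_plane z)
  (fun z => F z * hpow s 0 z)%C).
{ apply holo_mult.
  - apply holo_subset with (2 := holo_F). now intros z [Hz _].
  - apply holo_subset with (2 := holo_hpow s 0). now intros z [_ Hz]. }
destruct (hpow_growth s 0 a b Hb) as [K HK].
set (p := (x1 + x2) / 2).
apply (vline_shift _ (fun z => F z * hpow s 0 z)%C a b p x1 x2 l1 l2
  is_open_F_domain Hf); auto; try (unfold a, b, p; lra).
- destruct (proj1 (Ccontinuous_eps (fun z => F z * hpow s 0 z)%C (p, 0))
    (holo_continuous _ _ (p, 0) Hf (Hin p 0 ltac:(unfold a, b, p; lra))) 1 Rlt_0_1)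
    as [d [Hd H]].
  exists (d / 2), (1 + Cmod (F (p, 0)%R * hpow s 0 (p, 0)%R)%C). split; [lra|].
  intros x y Hx Hy _.
  specialize (H (x - p, y)). cbv beta in H.
  replace ((p, 0) + (x - p, y)%R)%C with ((x, y) : C) in H
    by (unfold Cplus; simpl; f_equal; ring).
  specialize (H ltac:(eapply Rle_lt_trans; [apply Cmod_le_Rabs|lra])).
  pose proof (Cmod_triangle (F (x, y) * hpow s 0 (x, y) - F (p, 0)%R * hpow s 0 (p, 0)%R)
    (F (p, 0)%R * hpow s 0 (p, 0)%R))%C as T.
  replace (F (x, y) * hpow s 0 (x, y) - F (p, 0)%R * hpow s 0 (p, 0)%R
    + F (p, 0)%R * hpow s 0 (p, 0)%R)%C with (F (x, y) * hpow s 0 (x, y))%C in T by ring.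
  lra.
- apply (F_strip_small (hpow s 0) a b K); [|exact HK].
  pose proof (HK a 0 ltac:(unfold a, b; lra)). pose proof (Cmod_ge_0 (hpow s 0 (a, 0))).
  pose proof (exp_pos (Rabs 0 / 2)). nra.
Qed.

Lemma F_hpow_lim_indep (s : C) (c : R) (l0 lc : C) : - (PI / 3) < c < PI / 3 ->
  sym_lim (fun y => F (0, y) * hpow s 0 (0, y))%C l0 ->
  sym_lim (fun y => F (c, y) * hpow s 0 (c, y))%C lc -> l0 = lc.
Proof.
intros Hc S0 Sc. pose proof PI_RGT_0.
destruct (Rtotal_order c 0) as [h|[-> |h]].
- symmetry. apply (F_hpow_lim_lt s c 0); auto; lra.
- exact (sym_lim_unique _ _ _ S0 Sc).
- apply (F_hpow_lim_lt s 0 c); auto; lra.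
Qed.

(** * Holomorphy in [s] *)

Lemma path_continuous_Cmult (a : C) (f : R -> C) (t : R) :
  path_continuous f t -> path_continuous (fun y => a * f y)%C t.
Proof.
intros H. apply (continuous_comp (V := C_UniformSpace) f (fun w : C => (a * w)%C) t H).
apply Ccontinuous_pair, Ccontinuous_mult; [apply Ccontinuous_const|].
exact (@continuous_id (AbsRing_UniformSpace C_AbsRing) (f t)).
Qed.

Lemma path_continuous_plus (f g : R -> C) (t : R) :
  path_continuous f t -> path_continuous g t ->
  path_continuous (fun y => f y + g y)%C t.
Proof.
exact (@continuous_plus R_UniformSpace R_AbsRing C_R_NormedModule f g t).
Qed.

Lemma F_vline_continuous (h : C -> C) (c : R) : - (PI / 3) < c < PI / 3 ->
  holo left_plane h -> forall t, path_continuous (fun y => F (c, y) * h (c, y))%C t.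
Proof.
intros Hc Hh t. apply (path_continuous_vline (fun z => F z * h z)%C).
apply Ccontinuous_mult.
- apply (holo_continuous _ F _ holo_F), F_denom_neq_0; right.
  now apply one_plus_2cos_neq_0.
- apply (holo_continuous left_plane h _ Hh). unfold left_plane; simpl; lra.
Qed.

Lemma hpow_0 (s z : C) : hpow s 0 z = Cexp (- s * ell z)%C.
Proof.
unfold hpow. do 3 f_equal. simpl. rewrite Rmult_0_l. destruct z.
unfold RtoC, Copp, Cplus; simpl; f_equal; ring.
Qed.

(** One majorant for everything in the differentiation: with [A = Cmod s + 2], the part [Cmod s]
    pays for the power of [u] and the 2 for polynomial factors in [ell]. *)
Lemma F_exp_ell_le (A c : R) : 0 <= A -> - (PI / 3) < c < PI / 3 ->
  exists K, 0 <= K /\ forall y,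
    Cmod (F (c, y)) * exp (A * Cmod (ell (c, y))) <= K * exp (- (Rabs y / 2)).
Proof.
intros HA Hc.
destruct (Cmod_F_le c (one_plus_2cos_neq_0 c Hc)) as [KF [KF0 HF]].
destruct (Cmod_ell_le A c c HA ltac:(lra)) as [B HB].
exists (KF * exp B). pose proof (exp_pos B). split; [nra|]. intros y.
replace (KF * exp B * exp (- (Rabs y / 2)))
  with (KF * exp (- Rabs y) * exp (B + Rabs y / 2)).
- apply Rmult_le_compat; [apply Cmod_ge_0|left; apply exp_pos|apply HF|].
  apply exp_le_compat, HB; lra.
- rewrite Rmult_assoc, <- exp_plus, Rmult_assoc, <- exp_plus.
  f_equal; f_equal. field.
Qed.

Lemma Cmod_hpow_0_le (s z : C) : Cmod (hpow s 0 z) <= exp (Cmod s * Cmod (ell z)).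
Proof.
rewrite hpow_0, Cmod_Cexp. apply exp_le_compat.
eapply Rle_trans; [apply Rle_abs|]. eapply Rle_trans; [apply re_le_Cmod|].
rewrite Cmod_mult, Cmod_opp. lra.
Qed.

Lemma hpow_0_plus (s w z : C) :
  hpow (s + w)%C 0 z = (hpow s 0 z * Cexp (- w * ell z))%C.
Proof. rewrite !hpow_0, <- Cexp_plus. f_equal. ring. Qed.

Lemma sqr_le_exp (x : R) : 0 <= x -> x * x <= 4 * exp x.
Proof.
intros Hx. pose proof (exp_ineq1_le (x / 2)) as H.
replace x with (x / 2 + x / 2) at 3 by field. rewrite exp_plus. nra.
Qed.

(** The first-order Taylor remainder in [s], since the derivative of [hpow s 0 z] is
    [- ell z * hpow s 0 z]. Sums and scalar factors replace subtractions so that the rules for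
    [holo] and [sym_lim] apply directly. *)
Definition hpow_remainder (s w z : C) : C :=
  (hpow (s + w) 0 z + - (1) * hpow s 0 z + - w * (- (1) * (ell z * hpow s 0 z)))%C.

(** After factoring out [hpow s 0 z], the exponential remainder is at most [5 |w|^2 L^2 exp (|w| L)]
    with [L = Cmod (ell z)]. As [L^2 <= 4 exp L] and [|w| <= 1], this yields the 20 and two extra
    factors [exp L]. *)
Lemma Cmod_hpow_remainder_le (s w z : C) : Cmod w <= 1 ->
  Cmod (hpow_remainder s w z) <=
  20 * (Cmod w * Cmod w) * exp ((Cmod s + 2) * Cmod (ell z)).
Proof.
intros Hw. unfold hpow_remainder. rewrite hpow_0_plus.
replace (hpow s 0 z * Cexp (- w * ell z) + - (1) * hpow s 0 z
  + - w * (- (1) * (ell z * hpow s 0 z)))%C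
  with (hpow s 0 z * (Cexp (- w * ell z) - 1 - - w * ell z))%C by ring.
rewrite Cmod_mult.
pose proof (Cexp_taylor1_le (- w * ell z)%C) as T.
rewrite Cmod_mult, Cmod_opp in T.
pose proof (Cmod_hpow_0_le s z) as H.
set (L := Cmod (ell z)) in *. assert (L0 : 0 <= L) by apply Cmod_ge_0.
pose proof (Cmod_ge_0 w) as W0.
assert (T' : Cmod (Cexp (- w * ell z) - 1 - - w * ell z)%C
  <= 20 * (Cmod w * Cmod w) * (exp L * exp L)).
{ eapply Rle_trans; [exact T|].
  replace (5 * (Cmod w * L * (Cmod w * L)) * exp (Cmod w * L))
    with (5 * (Cmod w * Cmod w) * (L * L * exp (Cmod w * L))) by ring.
  replace (20 * (Cmod w * Cmod w) * (exp L * exp L))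
    with (5 * (Cmod w * Cmod w) * (4 * exp L * exp L)) by ring.
  apply Rmult_le_compat_l; [nra|].
  apply Rmult_le_compat; [nra|left; apply exp_pos|now apply sqr_le_exp|].
  apply exp_le_compat. nra. }
replace ((Cmod s + 2) * L) with (Cmod s * L + (L + L)) by ring. rewrite !exp_plus.
replace (20 * (Cmod w * Cmod w) * (exp (Cmod s * L) * (exp L * exp L)))
  with (exp (Cmod s * L) * (20 * (Cmod w * Cmod w) * (exp L * exp L))) by ring.
apply Rmult_le_compat; auto using Cmod_ge_0.
Qed.

Lemma F_hpow_lim_derive (c : R) (l : C -> C) : - (PI / 3) < c < PI / 3 ->
  (forall s, sym_lim (fun y => F (c, y) * hpow s 0 (c, y))%C (l s)) ->
  forall s, exists d, is_Cderiv l s d.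
Proof.
intros Hc Hl s.
assert (Hd : holo left_plane (fun z => - (1) * (ell z * hpow s 0 z))%C).
{ apply holo_mult; [apply holo_const|].
  apply holo_mult; [apply holo_ell|apply holo_hpow]. }
pose proof (Cmod_ge_0 s) as S0.
destruct (F_exp_ell_le (Cmod s + 2) c ltac:(lra) Hc) as [K [K0 HK]].
assert (HB : exp_bounded K
  (fun y => F (c, y) * (- (1) * (ell (c, y) * hpow s 0 (c, y))))%C).
{ split; [now apply (F_vline_continuous (fun z => - (1) * (ell z * hpow s 0 z))%C)|].
  intros t. eapply Rle_trans; [|apply HK].
  rewrite Cmod_mult. apply Rmult_le_compat_l; [apply Cmod_ge_0|].
  rewrite !Cmod_mult, Cmod_opp, Cmod_1, Rmult_1_l.
  pose proof (Cmod_hpow_0_le s (c, t)) as H. pose proof (Cmod_ge_0 (ell (c, t))) as L0.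
  replace ((Cmod s + 2) * Cmod (ell (c, t)))
    with (2 * Cmod (ell (c, t)) + Cmod s * Cmod (ell (c, t))) by ring.
  rewrite exp_plus. apply Rmult_le_compat; auto using Cmod_ge_0.
  pose proof (exp_ineq1_le (2 * Cmod (ell (c, t)))). lra. }
destruct (ex_line_int K _ HB) as [d Hd'].
apply line_int_sym_lim in Hd'.
exists d. apply is_Cderiv_eps; intros eps Heps.
(* 80 is the 20 of the remainder bound times the 4 of [sym_lim_Cmod_le]. *)
exists (Rmin 1 (eps / (80 * K + 1))); split.
{ apply Rmin_glb_lt; [lra|]. apply Rdiv_lt_0_compat; lra. }
intros w Hw.
assert (W1 : Cmod w < 1) by (eapply Rlt_le_trans; [exact Hw|apply Rmin_l]).
assert (W2 : Cmod w * (80 * K + 1) <= eps).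
{ apply Rmult_le_reg_r with (/ (80 * K + 1)); [apply Rinv_0_lt_compat; lra|].
  rewrite Rmult_assoc, Rinv_r, Rmult_1_r by lra.
  left; eapply Rlt_le_trans; [exact Hw|apply Rmin_r]. }
assert (HR : exp_bounded (20 * (Cmod w * Cmod w) * K)
  (fun y => F (c, y) * hpow_remainder s w (c, y))%C).
{ split.
  - apply (F_vline_continuous (hpow_remainder s w) c Hc). unfold hpow_remainder.
    apply holo_plus; [apply holo_plus|].
    + apply holo_hpow.
    + apply holo_mult; [apply holo_const|apply holo_hpow].
    + apply holo_mult; [apply holo_const|exact Hd].
  - intros t. rewrite Cmod_mult.
    pose proof (Cmod_hpow_remainder_le s w (c, t) ltac:(lra)) as H.
    pose proof (HK t) as HKt.
    pose proof (Cmod_ge_0 (F (c, t))) as PF. pose proof (Cmod_ge_0 w) as PW.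
    apply Rle_trans with (Cmod (F (c, t)) * (20 * (Cmod w * Cmod w) *
      exp ((Cmod s + 2) * Cmod (ell (c, t))))); [now apply Rmult_le_compat_l|].
    replace (Cmod (F (c, t)) * (20 * (Cmod w * Cmod w) *
      exp ((Cmod s + 2) * Cmod (ell (c, t)))))
      with (20 * (Cmod w * Cmod w) * (Cmod (F (c, t)) *
      exp ((Cmod s + 2) * Cmod (ell (c, t))))) by ring.
    rewrite (Rmult_assoc _ K). apply Rmult_le_compat_l; [nra|exact HKt]. }
assert (HC : forall t, path_continuous (fun y => - w *
  (F (c, y) * (- (1) * (ell (c, y) * hpow s 0 (c, y)))))%C t)
  by (intros t; apply path_continuous_Cmult, HB).
assert (Cs : forall v t, path_continuous (fun y => F (c, y) * hpow v 0 (c, y))%C t)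
  by (intros v t; apply F_vline_continuous; auto using holo_hpow).
assert (SR : sym_lim (fun y => F (c, y) * hpow_remainder s w (c, y))%C
  (l (s + w) + - (1) * l s + - w * d)%C).
{ apply (sym_lim_ext (fun y => F (c, y) * hpow (s + w) 0 (c, y)
    + - (1) * (F (c, y) * hpow s 0 (c, y))
    + - w * (F (c, y) * (- (1) * (ell (c, y) * hpow s 0 (c, y)))))%C).
  - intros y. unfold hpow_remainder. ring.
  - apply sym_lim_plus; [|exact HC| |apply sym_lim_Cmult; [apply HB|exact Hd']].
    + intros t. apply path_continuous_plus; [apply Cs|apply (path_continuous_Cmult), Cs].
    + apply sym_lim_plus; [apply Cs|intros t; apply path_continuous_Cmult, Cs|apply Hl|].
      apply sym_lim_Cmult; [apply Cs|apply Hl]. }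
pose proof (sym_lim_Cmod_le _ _ _ HR SR) as Q.
replace (l (s + w) - l s - d * w)%C with (l (s + w) + - (1) * l s + - w * d)%C by ring.
eapply Rle_trans; [exact Q|].
pose proof (Cmod_ge_0 w). nra.
Qed.

(** * The line integral defining [Dstar] *)

Lemma exp_bounded_Cmult (a : C) (K : R) (f : R -> C) :
  exp_bounded K f -> exp_bounded (Cmod a * K) (fun t => a * f t)%C.
Proof.
intros [Hc Hb]; split; intros t.
- now apply path_continuous_Cmult.
- rewrite Cmod_mult, Rmult_assoc. apply Rmult_le_compat_l; [apply Cmod_ge_0|apply Hb].
Qed.

Lemma vline_integrand_eq (c : R) (s : C) (y : R) : c < PI / 3 ->
  (Ci * (F (c, y) * hpow s 0 (c, y)))%C = vline_integrand (Dstar_integrand s) c y.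
Proof.
intros Hc. unfold vline_integrand, Dstar_integrand.
rewrite hpow_eq by exact Hc. simpl INR. rewrite Rmult_0_l.
replace ((c, y) + - RtoC 0)%C with ((c, y) : C)
  by (unfold RtoC, Copp, Cplus; simpl; f_equal; ring).
ring.
Qed.

Lemma Dstar_integral (c : R) (s : C) : - (PI / 3) < c < PI / 3 ->
  ex_vline_int (Dstar_integrand s) c /\
  exists l, sym_lim (fun y => F (c, y) * hpow s 0 (c, y))%C l /\
    Dstar c s = (RtoC (/ (2 * PI)) * l)%C.
Proof.
intros Hc. pose proof PI_RGT_0 as HPI.
pose proof (one_plus_2cos_neq_0 c Hc) as Hc'.
destruct (F_hpow_exp_bounded s 0 c ltac:(lra) Hc') as [K HK].
destruct (ex_line_int _ _ (exp_bounded_Cmult Ci K _ HK)) as [l' Hl'].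
assert (Hv : is_line_int (vline_integrand (Dstar_integrand s) c) l').
{ revert Hl'. apply is_RInt_gen_ext. apply filter_forall. intros ab y _.
  apply vline_integrand_eq; lra. }
split; [now exists l'|].
destruct (F_hpow_sym_lim s 0 c ltac:(lra) Hc') as [l Hl].
exists l; split; [exact Hl|].
(* The improper integral with independent ends has the symmetric limit as its value; the factor [Ci]
   from [dz = i dy] then cancels the one in [1 / (2 PI i)]. *)
assert (E : l' = (Ci * l)%C).
{ apply (sym_lim_unique (fun y => Ci * (F (c, y) * hpow s 0 (c, y)))%C).
  - now apply line_int_sym_lim.
  - apply sym_lim_Cmult; [apply HK|exact Hl]. }
unfold Dstar, vline_int.
rewrite (is_RInt_gen_unique (V := C_R_CompleteNormedModule) _ l' Hv), E.
rewrite RtoC_inv, RtoC_mult by lra.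
field. split; intros E'; apply (f_equal Cmod) in E'; rewrite Cmod_0 in E'.
- rewrite Cmod_R, Rabs_pos_eq in E'; lra.
- rewrite Cmod_Ci in E'. lra.
Qed.

Theorem theorem2p1 (c : R) (hc : (- (PI / 3) < c < PI / 3)%R) :
  (forall s : C, ex_vline_int (Dstar_integrand s) c) /\
  entire (Dstar c) /\
  (forall s : C, (0 < Re s)%R -> is_dirichlet_series euler_coeff s (Dstar c s)).
Proof.
pose proof PI_RGT_0 as HPI.
split; [intros s; now apply Dstar_integral|]. split.
- set (l := fun s => (RtoC (2 * PI) * Dstar c s)%C).
  assert (Hl : forall s, sym_lim (fun y => F (c, y) * hpow s 0 (c, y))%C (l s)).
  { intros s. destruct (Dstar_integral c s hc) as [_ [l' [Hl' E]]].
    unfold l. rewrite E.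
    replace (RtoC (2 * PI) * (RtoC (/ (2 * PI)) * l'))%C with l'; [exact Hl'|].
    rewrite Cmult_assoc, <- RtoC_mult, Rinv_r by lra. ring. }
  intros s. destruct (F_hpow_lim_derive c l hc Hl s) as [d Hd].
  exists (RtoC (/ (2 * PI)) * d)%C.
  apply (is_Cderiv_Cmult (RtoC (/ (2 * PI)))) in Hd.
  (* The derivative is carried from the normed module of the ring [C] over itself to
     [C_NormedModule]; linearity is reproved and the remainder estimate is the same. *)
  apply (is_derive_ext (K := C_AbsRing) (V := C_NormedModule)
    (fun t => (RtoC (/ (2 * PI)) * l t)%C));
  [|split; [apply is_linear_scal_l|intros x Hx; exact (proj2 Hd x Hx)]].
  intros t. unfold l. rewrite Cmult_assoc, <- RtoC_mult, Rinv_l by lra.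
  apply Cmult_1_l.
- intros s Hs. destruct (Dstar_integral c s hc) as [_ [l [Hl E]]]. rewrite E.
  (* The crossings start from [Re z = 0], so the line at [c] is first moved there. *)
  destruct (F_hpow_sym_lim s 0 0 ltac:(lra) ltac:(rewrite Rmult_0_r, cos_0; lra))
    as [l0 Hl0].
  rewrite <- (F_hpow_lim_indep s c l0 l hc Hl0 Hl).
  now apply F_hpow_series.
Qed.
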